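(* Let $G$ be a finite metric graph and let $B=\{v_1,\dots,v_m\}\subset V$ be a set of vertices containing all boundary vertices and all proper core vertices of $G$. Let $\lambda>0$, let $G_\lambda$ be the subgraph of $G$ consisting of all edges whose lengths are natural multiples of $\pi/\sqrt{\lambda}$, and let $\beta_0^{\rm odd}(G_\lambda)$ be the number of connected components of $G_\lambda$ containing a cycle with odd length with respect to $\pi/\sqrt\lambda$. Then: (i) If $\beta_1(G_\lambda)=\beta_0^{\rm odd}(G_\lambda)$, then $\lambda$ is an eigenvalue of $-\Delta_G$ if and only if $\lambda$ is a pole of $M_B$, and $\dim\ker(-\Delta_G-\lambda)=\operatorname{rank}\operatorname{Res}_\lambda M_B$. (ii) If $\beta_1(G_\lambda)>\beta_0^{\rm odd}(G_\lambda)$, then $\lambda$ is an eigenvalue of $-\Delta_G$ and $$\dim\ker(-\Delta_G-\lambda)=\operatorname{rank}\operatorname{Res}_\lambda M_B+\beta_1(G_\lambda)-\beta_0^{\rm odd}(G_\lambda).$$ In particular, in this case $\lambda$ is a pole of $M_B$ if and only if $\dim\ker(-\Delta_G-\lambda)>\beta_1(G_\lambda)-\beta_0^{\rm odd}(G_\lambda)$.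
   Context: A finite metric graph $G$ has finite vertex set $V$ and finite edge set $E$ (loops and multiple edges allowed) with lengths $L:E\to(0,\infty)$, each edge $e$ identified with $[0,L(e)]$, whose endpoints are identified with the vertices $o(e)$ and $t(e)$. For edgewise-$H^2$ functions $f$ continuous at each vertex (common value $f(v)$), set $\partial_\nu f(v)=\sum_{t(e)=v} f_e'(L(e)) - \sum_{o(e)=v} f_e'(0)$. The Kirchhoff Laplacian $-\Delta_G$ in $L^2(G)$ acts as $-f_e''$ on each edge with domain the edgewise-$H^2$ functions continuous at each vertex with $\partial_\nu f(v)=0$ for all $v\in V$; it is self-adjoint with discrete spectrum $\sigma(-\Delta_G)$. Titchmarsh–Weyl matrix: for $\mu\in\mathbb{C}\setminus\sigma(-\Delta_G)$ and $l=1,\dots,m$, let $f^{(l)}$ be the (unique) edgewise-$H^2$ function continuous at all vertices with $-f_e^{(l)\prime\prime}=\mu f_e^{(l)}$ on every edge, $\partial_\nu f^{(l)}(v_l)=1$ and $\partial_\nu f^{(l)}(v)=0$ for $v\in V\setminus\{v_l\}$; then $M_B(\mu)\in\mathbb{C}^{m\times m}$ has entries $(M_B(\mu))_{k,l}=f^{(l)}(v_k)$. The function $\mu\mapsto M_B(\mu)$ is meromorphic on $\mathbb{C}$. For such a matrix function $R$, $\operatorname{Res}_\lambda R=\frac{1}{2\pi i}\int_\Gamma R(\mu)\,d\mu$ for a small closed Jordan curve $\Gamma$ surrounding $\lambda$ and no other singularity; $\lambda$ is a pole of $R$ iff $\operatorname{rank}\operatorname{Res}_\lambda R>0$ (poles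 of $M_B$ are of order one). The core of $G$ is its largest subgraph without vertices of degree one; a boundary vertex is a vertex of degree one; a proper core vertex is a vertex all of whose attached edges belong to the core. For a finite graph $H$, $\beta_1(H)=|E(H)|-|V(H)|+\beta_0(H)$, $\beta_0(H)$ being the number of connected components. A cycle has odd length with respect to $x>0$ if its total length is an odd multiple of $x$. *)

(* Defs.v *)
From mathcomp Require Import all_boot all_order all_algebra.
From mathcomp Require Import all_classical all_reals all_analysis.
From mathcomp Require Export complex.
Import Order.TTheory GRing.Theory Num.Theory.
Import numFieldTopology.Exports numFieldNormedType.Exports.

Set Implicit Arguments.
Unset Strict Implicit.
Unset Printing Implicit Defensive.

Local Open Scope ring_scope.

Section MetricGraph.

Variable R : realType.
Local Notation C := R[i].

Definition cR (x : R) : C := Complex x 0.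
Definition cexpi (th : R) : C := Complex (cos th) (sin th).

Definition deriv_on (a b : R) (f f' : R -> C) : Prop :=
  forall x, a <= x <= b ->
    ((fun h : R => (f (x + h) - f x) / cR h)
      @ within (fun h : R => h != 0 /\ a <= x + h <= b) (nbhs (0 : R))
      --> (f' x : C^o))%classic.

Variables (V E : finType) (o t : E -> V) (L : E -> R).

Definition edge_sol (mu : C) (f f1 : E -> R -> C) : Prop :=
  forall e, deriv_on 0 (L e) (f e) (f1 e) /\
    exists f2 : R -> C, deriv_on 0 (L e) (f1 e) f2 /\
      forall x, 0 <= x <= L e -> - f2 x = mu * f e x.

Definition vertex_cont (f : E -> R -> C) (F : V -> C) : Prop :=
  forall e, f e 0 = F (o e) /\ f e (L e) = F (t e).

Definition flux (f1 : E -> R -> C) (v : V) : C :=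
  \sum_(e | t e == v) f1 e (L e) - \sum_(e | o e == v) f1 e 0.

(** ker(-Delta_G - lam): functions on the graph (edge e identified with
    [0, L e]; represented by zero extension outside [0, L e]) in the domain
    of the Kirchhoff Laplacian with -f'' = lam f. *)
Definition kerset (lam : R) : set (E -> R -> C) :=
  (fun f => (forall e x, ~ (0 <= x <= L e) -> f e x = 0) /\
     exists (f1 : E -> R -> C) (F : V -> C),
       [/\ edge_sol (cR lam) f f1, vertex_cont f F & forall v, flux f1 v = 0]).

Definition is_eigenvalue (lam : R) : Prop :=
  exists2 f, kerset lam f & f <> (fun _ _ => 0).

Definition has_dim (S : set (E -> R -> C)) (n : nat) : Prop :=
  exists b : 'I_n -> E -> R -> C,
    [/\ forall i, S (b i),
        forall c : 'I_n -> C,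
          (fun e x => \sum_i c i * b i e x) = (fun _ _ => 0) -> forall i, c i = 0
      & forall f, S f -> exists c : 'I_n -> C,
          f = (fun e x => \sum_i c i * b i e x)].

Definition TW_matrix (m : nat) (vB : 'I_m -> V) (mu : C) : 'M[C]_m :=
  xget 0 (fun M : 'M[C]_m => forall l : 'I_m,
    exists (f f1 : E -> R -> C) (F : V -> C),
      [/\ edge_sol mu f f1, vertex_cont f F,
          forall v, flux f1 v = (if v == vB l then 1 else 0)
        & forall k, M k l = F (vB k)]).

Definition cint02pi (h : R -> C) : C :=
  cR (Rintegral lebesgue_measure `[0, 2 * pi]%classic (fun th => complex.Re (h th)))
  + 'i%C * cR (Rintegral lebesgue_measure `[0, 2 * pi]%classic (fun th => complex.Im (h th))).

(** Res_lam M_B = (1 / 2 pi i) \oint_Gamma M_B(mu) dmu, Gamma the circle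
    mu = lam + r e^{i theta} for any sufficiently small radius r. *)
Definition Res_TW (m : nat) (vB : 'I_m -> V) (lam : R) : 'M[C]_m :=
  xget 0 (fun A : 'M[C]_m => exists2 r0 : R, 0 < r0 &
    forall r : R, 0 < r < r0 ->
      A = \matrix_(k, l) ((2 * cR pi * 'i%C)^-1 *
             cint02pi (fun th => TW_matrix vB (cR lam + cR r * cexpi th) k l
                                  * ('i%C * cR r * cexpi th)))).

Definition is_pole (m : nat) (vB : 'I_m -> V) (lam : R) : Prop :=
  (0 < \rank (Res_TW vB lam))%N.

(** degree of v in the subgraph with edge set F (loops count twice) *)
Definition deg (F : {set E}) (v : V) : nat :=
  \sum_(e in F) ((o e == v) + (t e == v))%N.

(** edges of the core: the largest edge set whose subgraph has no vertex of
    degree one (the union of all such edge sets). *)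
Definition core_edges : {set E} :=
  \bigcup_(F : {set E} | [forall v, deg F v != 1%N]) F.

Definition boundary_vertex (v : V) : bool := deg [set: E] v == 1%N.

Definition proper_core_vertex (v : V) : bool :=
  [forall e, ((o e == v) || (t e == v)) ==> (e \in core_edges)].

Definition connects (e : E) (a b : V) : bool :=
  ((o e == a) && (t e == b)) || ((o e == b) && (t e == a)).

Definition Elam (lam : R) : {set E} :=
  [set e | `[< exists n : nat, L e = n%:R * (pi / Num.sqrt lam) >]].

Definition adj (F : {set E}) : rel V :=
  fun a b => [exists e in F, connects e a b].

Definition components (F : {set E}) : {set {set V}} :=
  [set [set y | connect (adj F) x y] | x : V].

Definition beta0 (F : {set E}) : nat := #|components F|.

Definition beta1 (F : {set E}) : int :=
  (#|F|%:Z - #|V|%:Z + (beta0 F)%:Z)%R.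

Definition is_cycle (F : {set E}) (k : nat) (es : 'I_k -> E) (ws : 'I_k -> V) : Prop :=
  [/\ (0 < k)%N, injective es, injective ws,
      forall i, es i \in F
    & forall i, connects (es i) (ws i) (ws (ordS i))].

Definition odd_length (x : R) (k : nat) (es : 'I_k -> E) : Prop :=
  exists n : nat, odd n /\ \sum_i L (es i) = n%:R * x.

Definition beta0_odd (F : {set E}) (x : R) : nat :=
  #|[set Cm in components F | `[< exists k (es : 'I_k -> E) (ws : 'I_k -> V),
        [/\ is_cycle F es ws, odd_length x es & forall i, ws i \in Cm] >]]|.

End MetricGraph.

(* Main.v *)
Require Import Defs.
From mathcomp Require Import all_boot all_order all_algebra.
From mathcomp Require Import all_classical all_reals all_analysis.
From mathcomp Require Import complex ring lra zify.
Import Order.TTheory GRing.Theory Num.Theory.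
Import numFieldTopology.Exports numFieldNormedType.Exports.
Set Implicit Arguments.
Unset Strict Implicit.
Unset Printing Implicit Defensive.
Local Open Scope ring_scope.

(** Write a solution of [-f'' = mu f] on an edge in terms of [f(0)], [f'(0)] and
    the entire functions [cos (sqrt mu x)], [sin (sqrt mu x) / sqrt mu].  The
    vertex conditions become a square linear system [D(mu)] in the unknowns
    "slopes at origins, vertex values", and [M_B] is a compression of [D(mu)^-1].

    Near [mu = lam + z], [D = D0 + z Dq(z)].  If [P] projects onto [ker D0] then
    [z D^-1 = E^-1 (z (1 - P) + P)] with [E = (1 - P) D + P Dq] analytic, and
    [E(0)] is invertible because Green's identity makes the pairing of [w D1]
    with the conjugate dual vector of [w] equal to the squared [L^2] norm of the
    eigenfunction [w].  Hence the pole is simple, and the same pairing shows that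
    the residue has the rank of the evaluation map [ker D0 -> C^B].

    The kernel of that evaluation map is purely combinatorial.  The edges on
    which an eigenfunction vanishing on [B] is nonzero form a subgraph without
    vertices of degree one, so it vanishes at every vertex, is a multiple of a
    sine on each edge of [G_lam] and zero elsewhere, and the flux conditions say
    that the coefficients form a cycle of a signed graph; the rank of the signed
    incidence matrix counts the components without odd cycle. *)

(** * Uniform limits of polynomials *)

(** The residue is by definition a circle integral, so the one consequence of analyticity that is
    used is the mean value property. It passes from polynomials to their uniform limits, and germs
    of such limits are closed under sums, products and inverses with nonzero value at 0, hence under
    matrix inversion. Near [z = 0] only [z M_B(lam + z)] has to agree with such a germ: the
    differential along the circle supplies the factor [z]. Divided differences in [z], instead of
    derivatives, make the expansion of [D] exact, without a remainder to estimate. [D0] is not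
    Hermitian, since its rows list unknowns and its columns list conditions of another nature. A
    left null vector therefore needs a partner among the right null vectors: the conjugates of the
    derivatives at the terminal ends and of the negated vertex values of the same eigenfunction.
    With this partner the first-order pairing becomes Hermitian and positive. The final count uses
    rank-nullity for the evaluation map on [ker D0] and for the signed incidence matrix together
    with its transpose. *)

Section ComplexNorm.
Variable R : realType.
Local Notation C := R[i].
Implicit Types z w : C.

Definition cnorm z : R := Num.sqrt (complex.Re z ^+ 2 + complex.Im z ^+ 2).

Lemma cR_inj : injective (@cR R). Proof. by move=> x y []. Qed.
Lemma cR0 : cR 0 = 0 :> C. Proof. by []. Qed.
Lemma cR1 : cR 1 = 1 :> C. Proof. by []. Qed.
Lemma cRD (x y : R) : cR (x + y) = cR x + cR y.
Proof. by apply/eqP; rewrite eq_complex /= addr0 !eqxx. Qed.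
Lemma cRN (x : R) : cR (- x) = - cR x.
Proof. by apply/eqP; rewrite eq_complex /= oppr0 !eqxx. Qed.
Lemma cRB (x y : R) : cR (x - y) = cR x - cR y.
Proof. by rewrite cRD cRN. Qed.
Lemma cRM (x y : R) : cR (x * y) = cR x * cR y.
Proof. by apply/eqP; rewrite eq_complex /= !(mulr0, mul0r, subr0, addr0) !eqxx. Qed.
Lemma cR_nat n : cR n%:R = n%:R :> C.
Proof. by elim: n => [//|n IH]; rewrite -addn1 !natrD cRD IH. Qed.
Lemma cRX (x : R) n : cR (x ^+ n) = cR x ^+ n.
Proof. by elim: n => [//|n IH]; rewrite !exprS cRM IH. Qed.
Lemma cR_eq0 (x : R) : (cR x == 0) = (x == 0).
Proof. by rewrite (inj_eq cR_inj). Qed.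
Lemma cRV (x : R) : cR x^-1 = (cR x)^-1.
Proof.
have [->|x0] := eqVneq x 0; first by rewrite !invr0.
have cx0 : cR x != 0 by rewrite cR_eq0.
by apply: (mulfI cx0); rewrite -cRM !divff.
Qed.

Lemma cnormE z : cnorm z = Normc.normc z. Proof. by case: z. Qed.

Lemma normr_cnorm z : `|z| = cR (cnorm z). Proof. exact: normc_def. Qed.

Lemma cnorm0 : cnorm 0 = 0. Proof. by rewrite cnormE Normc.normc0. Qed.
Lemma cnorm1 : cnorm 1 = 1. Proof. by rewrite cnormE Normc.normc1. Qed.
Lemma cnormM z w : cnorm (z * w) = cnorm z * cnorm w.
Proof. by rewrite !cnormE Normc.normcM. Qed.
Lemma cnormV z : cnorm z^-1 = (cnorm z)^-1.
Proof. by rewrite !cnormE Normc.normcV. Qed.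
Lemma cnormD z w : cnorm (z + w) <= cnorm z + cnorm w.
Proof. by rewrite !cnormE; exact: le_normcD. Qed.
Lemma cnormN z : cnorm (- z) = cnorm z.
Proof. by rewrite !cnormE; exact: normcN. Qed.
Lemma cnormB z w : cnorm (z - w) <= cnorm z + cnorm w.
Proof. by rewrite -(cnormN w) cnormD. Qed.
Lemma cdistC z w : cnorm (z - w) = cnorm (w - z).
Proof. by rewrite -cnormN opprB. Qed.
Lemma cnorm_ge0 z : 0 <= cnorm z. Proof. exact: sqrtr_ge0. Qed.
Lemma cnorm_eq0 z : (cnorm z == 0) = (z == 0).
Proof.
apply/eqP/eqP => [|->]; last exact: cnorm0.
by rewrite cnormE => /Normc.eq0_normc.
Qed.
Lemma cnormX z n : cnorm (z ^+ n) = cnorm z ^+ n.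
Proof. by elim: n => [|n IH]; rewrite ?expr0 ?cnorm1 // !exprS cnormM IH. Qed.
Lemma cnorm_sum (I : Type) (r : seq I) (P : pred I) (F : I -> C) :
  cnorm (\sum_(i <- r | P i) F i) <= \sum_(i <- r | P i) cnorm (F i).
Proof.
elim/big_ind2: _ => [|x1 x2 y1 y2 h1 h2|//]; first by rewrite cnorm0.
by apply: le_trans (cnormD _ _) _; exact: lerD.
Qed.
Lemma cnorm_cR (x : R) : cnorm (cR x) = `|x|.
Proof. by rewrite /cnorm /= expr0n /= addr0 sqrtr_sqr. Qed.
Lemma cnorm_Re z : `|complex.Re z| <= cnorm z.
Proof.
by rewrite -(sqrtr_sqr (complex.Re z)) /cnorm ler_wsqrtr // lerDl sqr_ge0.
Qed.
Lemma cnorm_Im z : `|complex.Im z| <= cnorm z.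
Proof.
by rewrite -(sqrtr_sqr (complex.Im z)) /cnorm ler_wsqrtr // lerDr sqr_ge0.
Qed.
Lemma cnorm_le z : cnorm z <= `|complex.Re z| + `|complex.Im z|.
Proof.
rewrite -(ler_pXn2r (n := 2)) ?nnegrE ?sqrtr_ge0 ?addr_ge0 //.
rewrite /cnorm sqr_sqrtr ?addr_ge0 ?sqr_ge0 // sqrrD !real_normK ?num_real //.
by rewrite addrAC lerDl mulrn_wge0 // mulr_ge0.
Qed.
Lemma cnorm_eq0_eps z : (forall eps : R, 0 < eps -> cnorm z <= eps) -> z = 0.
Proof.
move=> h; apply/eqP; rewrite -cnorm_eq0 eq_le cnorm_ge0 andbT.
by apply/ler_addgt0Pl => e e0; rewrite addr0; exact: h.
Qed.

End ComplexNorm.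

Section UniformPolyApprox.
Variable R : realType.
Local Notation C := R[i].
Implicit Types (z w : C) (h k : C -> C) (p q : {poly C}).

(* Germs at 0 of uniform limits of polynomials: a substitute for analytic
   germs that is closed under the field operations and for which the mean
   value property is inherited from polynomials. *)
Definition uapprox h : Prop := exists2 rho : R, 0 < rho &
  forall eps : R, 0 < eps -> exists p : {poly C},
    forall z, cnorm z <= rho -> cnorm (h z - p.[z]) <= eps.

Lemma poly_bound p (rho : R) : exists2 B : R, 0 < B &
  forall z, cnorm z <= rho -> cnorm p.[z] <= B.
Proof.
elim/poly_ind: p => [|p c [B B0 hB]].
  by exists 1 => // z _; rewrite horner0 cnorm0.
exists (B * (1 + `|rho|) + cnorm c).
  by rewrite ltr_pwDl ?cnorm_ge0 // mulr_gt0 // ltr_pwDl.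
move=> z hz; rewrite hornerMXaddC.
apply: le_trans (cnormD _ _) _; rewrite lerD2r cnormM.
apply: ler_pM; rewrite ?cnorm_ge0 ?hB //.
by apply: le_trans hz _; have := ler_norm rho; lra.
Qed.

Lemma poly_lip0 p : exists2 B : R, 0 < B &
  forall z, cnorm z <= 1 -> cnorm (p.[z] - p.[0]) <= B * cnorm z.
Proof.
elim/poly_ind: p => [|p c _].
  by exists 1 => // z _; rewrite !horner0 subr0 cnorm0 mul1r cnorm_ge0.
have [B B0 hB] := poly_bound p 1.
exists B => // z hz; rewrite !hornerMXaddC mulr0 add0r addrK cnormM.
by rewrite ler_wpM2r ?cnorm_ge0 ?hB.
Qed.

(** Continuity at the centre is enough: it yields local boundedness, used for products, and
    nonvanishing near 0, used for inverses. *)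
Lemma uapprox_cont0 h : uapprox h -> forall eps : R, 0 < eps ->
  exists2 rho : R, 0 < rho & forall z, cnorm z <= rho -> cnorm (h z - h 0) <= eps.
Proof.
move=> [rho rho0 hh] e e0; have [|p hp] := hh (e / 4); first by lra.
have [B B0 hB] := poly_lip0 p.
exists (Num.min rho (Num.min 1 (e / 4 / B))).
  by rewrite !lt_min rho0 ltr01 /= divr_gt0 //; lra.
move=> z; rewrite !le_min => /and3P[h1 h2 h3].
have -> : h z - h 0 = (h z - p.[z]) + (p.[z] - p.[0]) - (h 0 - p.[0]) by ring.
apply: le_trans (cnormB _ _) _.
have := cnormD (h z - p.[z]) (p.[z] - p.[0]).
have := hp z h1; have := hB z h2.
have : cnorm (0 : C) <= rho by rewrite cnorm0 ltW.
move=> /hp; rewrite ler_pdivlMr // mulrC in h3; lra.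
Qed.

Lemma uapprox_bounded h : uapprox h -> exists rho B : R,
  [/\ 0 < rho, 0 < B & forall z, cnorm z <= rho -> cnorm (h z) <= B].
Proof.
move=> uh; have [rho r0 hr] := uapprox_cont0 uh ltr01.
exists rho, (cnorm (h 0) + 1); split=> //.
  by have := cnorm_ge0 (h 0); lra.
move=> z /hr; have := cnormD (h z - h 0) (h 0); rewrite subrK; lra.
Qed.

Lemma uapprox_shrink h (r : R) : uapprox h -> 0 < r ->
  exists2 rho : R, 0 < rho <= r &
  forall eps : R, 0 < eps -> exists p : {poly C},
    forall z, cnorm z <= rho -> cnorm (h z - p.[z]) <= eps.
Proof.
move=> [rho rho0 hh] r0; exists (Num.min rho r).
  by rewrite lt_min rho0 r0 ge_min lexx orbT.
move=> e /hh [p hp]; exists p => z; rewrite le_min => /andP[hz _]; exact: hp.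
Qed.

Lemma uapprox_ext h k (r : R) : 0 < r ->
  (forall z, cnorm z <= r -> h z = k z) -> uapprox h -> uapprox k.
Proof.
move=> r0 hk uh; have [rho /andP[rho0 rr] hh] := uapprox_shrink uh r0.
exists rho => // e /hh[p hp]; exists p => z hz.
by rewrite -hk ?hp // (le_trans hz).
Qed.

Lemma uapprox_poly p : uapprox (fun z => p.[z]).
Proof.
by exists 1 => // e e0; exists p => z _; rewrite subrr cnorm0 ltW.
Qed.

Lemma uapprox_cst (c : C) : uapprox (fun=> c).
Proof.
apply: uapprox_ext (uapprox_poly c%:P) => [|z _]; first exact: ltr01.
by rewrite hornerC.
Qed.

Lemma uapprox_id : uapprox id.
Proof.
apply: uapprox_ext (uapprox_poly 'X) => [|z _]; first exact: ltr01.
by rewrite hornerX.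
Qed.

Lemma uapproxD h k : uapprox h -> uapprox k -> uapprox (fun z => h z + k z).
Proof.
move=> [r1 r10 hh] /uapprox_shrink /(_ r10) [r /andP[r0 rr1] hk].
exists r => // e e0.
have [|p hp] := hh (e / 2); first lra.
have [|q hq] := hk (e / 2); first lra.
exists (p + q) => z hz; rewrite hornerD opprD addrACA.
apply: le_trans (cnormD _ _) _.
have := hp z (le_trans hz rr1); have := hq z hz; lra.
Qed.

Lemma uapproxM h k : uapprox h -> uapprox k -> uapprox (fun z => h z * k z).
Proof.
move=> uh uk.
have [r1 [B1 [r10 B10 hB1]]] := uapprox_bounded uh.
have [r2 [B2 [r20 B20 hB2]]] := uapprox_bounded uk.
have [r3 /andP[r30 r31] hh] := uapprox_shrink uh r10.
have [r4 /andP[r40 r42] hk] := uapprox_shrink uk r20.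
exists (Num.min r3 r4); first by rewrite lt_min r30.
move=> e e0.
(* The cap 1 bounds [q] by [B2 + 1] on the disc, so that the tolerance for [p] can be fixed
   independently of [q]. *)
have e10 : 0 < Num.min 1 (e / (2 * B1)).
  by rewrite lt_min ltr01 /= divr_gt0 // mulr_gt0.
have e20 : 0 < e / (2 * (B2 + 1)) by rewrite divr_gt0 // mulr_gt0 //; lra.
have [q hq] := hk _ e10; have [p hp] := hh _ e20.
exists (p * q) => z; rewrite le_min => /andP[z3 z4]; rewrite hornerM.
have -> : h z * k z - p.[z] * q.[z]
  = h z * (k z - q.[z]) + (h z - p.[z]) * q.[z] by ring.
apply: le_trans (cnormD _ _) _; rewrite !cnormM.
have := hq z z4; rewrite le_min => /andP[q1 q2].
have hqz : cnorm q.[z] <= B2 + 1.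
  have := cnormB (k z) (k z - q.[z]); rewrite opprB addrC subrK.
  by have := hB2 z (le_trans z4 r42); lra.
have a1 : cnorm (h z) * cnorm (k z - q.[z]) <= B1 * (e / (2 * B1)).
  by apply: ler_pM; rewrite ?cnorm_ge0 // hB1 // (le_trans z3).
have a2 : cnorm (h z - p.[z]) * cnorm q.[z] <= e / (2 * (B2 + 1)) * (B2 + 1).
  by apply: ler_pM; rewrite ?cnorm_ge0 // hp.
have -> : e = B1 * (e / (2 * B1)) + e / (2 * (B2 + 1)) * (B2 + 1).
  by field; rewrite !gt_eqF //; lra.
exact: lerD.
Qed.

Lemma uapproxN h : uapprox h -> uapprox (fun z => - h z).
Proof.
move=> uh; apply: uapprox_ext (uapproxM (uapprox_cst (-1)) uh) => [|z _].
  exact: ltr01.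
by rewrite mulN1r.
Qed.

Lemma uapprox_sum (I : Type) (r : seq I) (P : pred I) (F : I -> C -> C) :
  (forall i, uapprox (F i)) -> uapprox (fun z => \sum_(i <- r | P i) F i z).
Proof.
move=> hF; elim: r => [|i r IH].
  by apply: uapprox_ext (uapprox_cst 0) => [|z _]; [exact: ltr01|rewrite big_nil].
case: (boolP (P i)) => Pi.
  apply: uapprox_ext (uapproxD (hF i) IH) => [|z _]; first exact: ltr01.
  by rewrite big_cons Pi.
by apply: uapprox_ext IH => [|z _]; [exact: ltr01|rewrite big_cons (negbTE Pi)].
Qed.

Lemma uapprox_prod (I : Type) (r : seq I) (P : pred I) (F : I -> C -> C) :
  (forall i, uapprox (F i)) -> uapprox (fun z => \prod_(i <- r | P i) F i z).
Proof.
move=> hF; elim: r => [|i r IH].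
  by apply: uapprox_ext (uapprox_cst 1) => [|z _]; [exact: ltr01|rewrite big_nil].
case: (boolP (P i)) => Pi.
  apply: uapprox_ext (uapproxM (hF i) IH) => [|z _]; first exact: ltr01.
  by rewrite big_cons Pi.
by apply: uapprox_ext IH => [|z _]; [exact: ltr01|rewrite big_cons (negbTE Pi)].
Qed.

Lemma uapprox_neq0 h : uapprox h -> h 0 != 0 ->
  exists2 rho : R, 0 < rho & forall z, cnorm z <= rho -> h z != 0.
Proof.
move=> uh h0; have n0 : 0 < cnorm (h 0) by rewrite lt0r cnorm_eq0 h0 cnorm_ge0.
have [|rho r0 hr] := uapprox_cont0 uh (eps := cnorm (h 0) / 2); first lra.
exists rho => // z /hr; apply: contraTneq => ->.
by rewrite sub0r cnormN -ltNge; lra.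
Qed.

Lemma expr34_small (e : R) : 0 < e -> exists N, (3 / 4) ^+ N <= e :> R.
Proof.
move=> e0; have : ((3 / 4) ^+ n @[n --> \oo] --> (0 : R))%classic.
  by apply: cvg_expr; rewrite ger0_norm; lra.
move=> /cvgrPdist_le /(_ e e0) [N _ /(_ N (leqnn N))].
by rewrite /= sub0r normrN ger0_norm ?exprn_ge0 //; exists N.
Qed.

(* Neumann series. *)
Lemma uapprox_inv1 h : uapprox h -> h 0 = 1 -> uapprox (fun z => (h z)^-1).
Proof.
move=> uh h0.
have [|r1 r10 hr1] := uapprox_cont0 uh (eps := 1 / 2); first lra.
have [r /andP[r0 rr1] hr] := uapprox_shrink uh r10.
exists r => // e e0.
have [|N hN] := expr34_small (e := e / 4); first lra.
(* The tolerance 1/4 gives [|1 - p| <= 1/2 + 1/4] and [|p| >= 1/4]; since [p S = 1 - (1 - p)^N] has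
   norm at most 2, [|S| <= 8]. The error is then at most [(e/4 + 8 e/32) / |h|] with
   [|h| >= 1/2]. *)
have d0 : 0 < Num.min (1 / 4) (e / 32) by rewrite lt_min; apply/andP; split; lra.
have [p hp] := hr _ d0; exists (\sum_(i < N) (1 - p) ^+ i) => z hz.
have hzp := hp z hz; move: hzp; rewrite le_min => /andP[e1 e2].
have hz1 := hr1 z (le_trans hz rr1); rewrite h0 in hz1.
pose S := (\sum_(i < N) (1 - p) ^+ i).[z]; rewrite -/S.
have hS : p.[z] * S = 1 - (1 - p.[z]) ^+ N.
  rewrite -[X in X - _](expr1n _ N) subrXX /S horner_sum.
  have -> : 1 - (1 - p.[z]) = p.[z] by ring.
  congr (_ * _); apply: eq_bigr => i _.
  by rewrite expr1n mul1r horner_exp !hornerE.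
have hq : cnorm (1 - p.[z]) <= 3 / 4.
  have := cnormB (h z - p.[z]) (h z - 1).
  have -> : h z - p.[z] - (h z - 1) = 1 - p.[z] by ring.
  lra.
have hqN : cnorm (1 - p.[z]) ^+ N <= (3 / 4) ^+ N.
  by rewrite lerXn2r ?nnegrE ?cnorm_ge0 //; lra.
have hp4 : 1 / 4 <= cnorm p.[z].
  by have := cnormD p.[z] (1 - p.[z]); rewrite addrC subrK cnorm1; lra.
have hh2 : 1 / 2 <= cnorm (h z).
  by have := cnormB (h z) (h z - 1); rewrite opprB addrC subrK cnorm1; lra.
have hN1 : (3 / 4) ^+ N <= 1 :> R by rewrite exprn_ile1 //; lra.
have hS8 : cnorm S <= 8.
  have := cnormB 1 ((1 - p.[z]) ^+ N); rewrite -hS !cnormM cnorm1 cnormX.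
  have := cnorm_ge0 S; nra.
have hz0 : h z != 0 by rewrite -cnorm_eq0 gt_eqF //; lra.
have -> : (h z)^-1 - S = ((1 - p.[z]) ^+ N - (h z - p.[z]) * S) / h z.
  have -> : (1 - p.[z]) ^+ N = 1 - p.[z] * S by rewrite hS; ring.
  by field.
rewrite cnormM cnormV ler_pdivrMr; last lra.
apply: le_trans (cnormB _ _) _; rewrite cnormM cnormX.
have := cnorm_ge0 (h z - p.[z]); have := cnorm_ge0 S; nra.
Qed.

Lemma uapproxV h : uapprox h -> h 0 != 0 -> uapprox (fun z => (h z)^-1).
Proof.
move=> uh h0.
have u1 : uapprox (fun z => (h z / h 0)^-1).
  by apply: uapprox_inv1 (divff h0); exact: uapproxM uh (uapprox_cst _).
apply: uapprox_ext (uapproxM (uapprox_cst (h 0)^-1) u1) => [|z _].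
  exact: ltr01.
by rewrite invfM invrK mulrCA mulVf ?mulr1.
Qed.

Definition mx_uapprox m n (M : C -> 'M[C]_(m, n)) : Prop :=
  forall i j, uapprox (fun z => M z i j).

Lemma uapprox_det n (M : C -> 'M[C]_n) : mx_uapprox M ->
  uapprox (fun z => \det (M z)).
Proof.
move=> hM; apply: uapprox_sum => s; apply: uapproxM; first exact: uapprox_cst.
by apply: uapprox_prod => i.
Qed.

Lemma mx_uapproxM m n l (M : C -> 'M[C]_(m, n)) (N : C -> 'M[C]_(n, l)) :
  mx_uapprox M -> mx_uapprox N -> mx_uapprox (fun z => M z *m N z).
Proof.
move=> hM hN i j.
apply: (@uapprox_ext (fun z => \sum_k M z i k * N z k j) _ 1) => [|z _|].
- exact: ltr01.
- by rewrite mxE.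
- by apply: uapprox_sum => k; exact: uapproxM.
Qed.

Lemma mx_uapproxD m n (M N : C -> 'M[C]_(m, n)) :
  mx_uapprox M -> mx_uapprox N -> mx_uapprox (fun z => M z + N z).
Proof.
move=> hM hN i j.
apply: (@uapprox_ext (fun z => M z i j + N z i j) _ 1) => [|z _|].
- exact: ltr01.
- by rewrite mxE.
- exact: uapproxD.
Qed.

Lemma mx_uapproxZ m n (h : C -> C) (M : C -> 'M[C]_(m, n)) :
  uapprox h -> mx_uapprox M -> mx_uapprox (fun z => h z *: M z).
Proof.
move=> hh hM i j.
apply: (@uapprox_ext (fun z => h z * M z i j) _ 1) => [|z _|].
- exact: ltr01.
- by rewrite mxE.
- exact: uapproxM.
Qed.

Lemma mx_uapprox_cst m n (M : 'M[C]_(m, n)) : mx_uapprox (fun=> M).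
Proof. by move=> i j; exact: uapprox_cst. Qed.

Lemma mx_uapprox_inv n (M : C -> 'M[C]_n) : mx_uapprox M -> M 0 \in unitmx ->
  exists2 rho : R, 0 < rho & forall z, cnorm z <= rho -> M z \in unitmx.
Proof.
rewrite unitmxE unitfE => hM h0.
have [rho r0 hr] := uapprox_neq0 (uapprox_det hM) h0.
by exists rho => // z hz; rewrite unitmxE unitfE; exact: hr.
Qed.

Lemma mx_uapproxV n (M : C -> 'M[C]_n) : mx_uapprox M -> M 0 \in unitmx ->
  mx_uapprox (fun z => invmx (M z)).
Proof.
move=> hM h0 i j; have [rho r0 hr] := mx_uapprox_inv hM h0.
(* The cofactor formula describes [invmx] only at invertible matrices, hence the restriction to the
   disc of radius [rho]. *)
apply: (@uapprox_ext
  (fun z => (\det (M z))^-1 * ((-1) ^+ (j + i) * \det (row' j (col' i (M z))))) _ rho) => //.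
  by move=> z hz; rewrite /invmx hr // !mxE.
apply: uapproxM.
  by apply: uapproxV; [exact: uapprox_det|rewrite unitmxE unitfE in h0].
apply: uapproxM; first exact: uapprox_cst.
apply: uapprox_det => k l.
apply: uapprox_ext (hM (lift j k) (lift i l)) => [|z _]; first exact: ltr01.
by rewrite !mxE.
Qed.

End UniformPolyApprox.

(** * Mean value property *)

Section ComplexDerivative.
Variable R : realType.
Local Notation C := R[i].
Implicit Types (f g : R -> C) (x : R) (d : C).

Definition cder f x d : Prop :=
  is_derive x 1 (fun t => complex.Re (f t)) (complex.Re d) /\
  is_derive x 1 (fun t => complex.Im (f t)) (complex.Im d).

Lemma ReD (z w : C) : complex.Re (z + w) = complex.Re z + complex.Re w.
Proof. by case: z; case: w. Qed.
Lemma ImD (z w : C) : complex.Im (z + w) = complex.Im z + complex.Im w.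
Proof. by case: z; case: w. Qed.
Lemma ReB (z w : C) : complex.Re (z - w) = complex.Re z - complex.Re w.
Proof. by case: z; case: w. Qed.
Lemma ImB (z w : C) : complex.Im (z - w) = complex.Im z - complex.Im w.
Proof. by case: z; case: w. Qed.
Lemma ReM (z w : C) : complex.Re (z * w) =
  complex.Re z * complex.Re w - complex.Im z * complex.Im w.
Proof. by case: z; case: w. Qed.
Lemma ImM (z w : C) : complex.Im (z * w) =
  complex.Re z * complex.Im w + complex.Im z * complex.Re w.
Proof. by case: z; case: w. Qed.

Lemma cder_cst (c : C) x : cder (fun=> c) x 0.
Proof. by split; exact: is_derive_cst. Qed.

Lemma cderD f g x df dg : cder f x df -> cder g x dg ->
  cder (fun t => f t + g t) x (df + dg).
Proof.
move=> [f1 f2] [g1 g2]; split.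
  rewrite ReD (_ : (fun t => _) = (fun t => complex.Re (f t)) + (fun t => complex.Re (g t))).
    exact: is_deriveD.
  by apply/funext => t; rewrite ReD.
rewrite ImD (_ : (fun t => _) = (fun t => complex.Im (f t)) + (fun t => complex.Im (g t))).
  exact: is_deriveD.
by apply/funext => t; rewrite ImD.
Qed.

Lemma cderM f g x df dg : cder f x df -> cder g x dg ->
  cder (fun t => f t * g t) x (df * g x + f x * dg).
Proof.
move=> [f1 f2] [g1 g2]; split.
  rewrite (_ : (fun t => _) =
    (fun t => complex.Re (f t)) * (fun t => complex.Re (g t)) -
    (fun t => complex.Im (f t)) * (fun t => complex.Im (g t))).
    apply: is_derive_eq; rewrite ReD !ReM /GRing.scale /=; ring.
  by apply/funext => t; rewrite ReM.
rewrite (_ : (fun t => _) =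
    (fun t => complex.Re (f t)) * (fun t => complex.Im (g t)) +
    (fun t => complex.Im (f t)) * (fun t => complex.Re (g t))).
  apply: is_derive_eq; rewrite ImD !ImM /GRing.scale /=; ring.
by apply/funext => t; rewrite ImM.
Qed.

Lemma cder_eq f x d d' : cder f x d -> d = d' -> cder f x d'.
Proof. by move=> ? <-. Qed.

Lemma cder_id x : cder (@cR R) x 1.
Proof. by split => /=; [exact: is_derive_id|exact: is_derive_cst]. Qed.

Lemma cder_poly (p : {poly C}) f x d : cder f x d ->
  cder (fun t => p.[f t]) x (p^`().[f x] * d).
Proof.
move=> fd; elim/poly_ind: p => [|p c IH].
  rewrite deriv0 horner0 mul0r (_ : (fun t => _) = fun=> 0); first exact: cder_cst.
  by apply/funext => t; rewrite horner0.
rewrite (_ : (fun t => _) = (fun t => p.[f t] * f t + c)); last first.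
  by apply/funext => t; rewrite hornerMXaddC.
apply: cder_eq; first by apply: cderD (cder_cst _ _); exact: cderM IH fd.
by rewrite derivMXaddC hornerD hornerM hornerX; ring.
Qed.

Lemma cder_cexpi x : cder (@cexpi R) x ('i%C * cexpi x).
Proof.
split.
  apply: (is_derive_eq (is_derive_cos x)).
  by rewrite ReM /= !mul0r mul1r sub0r.
apply: (is_derive_eq (is_derive_sin x)).
by rewrite ImM /= !mul0r mul1r add0r.
Qed.

Lemma is_derive_continuous (f : R -> R) (df : R -> R) :
  (forall x, is_derive x 1 f (df x)) -> continuous f.
Proof.
move=> h x; apply: differentiable_continuous; apply/derivable1_diffP.
by case: (h x).
Qed.

Lemma cder_continuous f (df : R -> C) : (forall x, cder f x (df x)) ->
  continuous (fun t => complex.Re (f t)) /\ continuous (fun t => complex.Im (f t)).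
Proof.
move=> h; split.
  by apply: (@is_derive_continuous _ (fun x => complex.Re (df x))) => x; case: (h x).
by apply: (@is_derive_continuous _ (fun x => complex.Im (df x))) => x; case: (h x).
Qed.

Local Notation mu := (@lebesgue_measure R).
Local Notation Itau := `[0, 2 * pi]%classic.

Lemma pi2_gt0 : 0 < 2 * pi :> R. Proof. by rewrite mulr_gt0 ?pi_gt0. Qed.

Lemma Rintegral_FTC (F f : R -> R) : (forall x, is_derive x 1 F (f x)) ->
  continuous f -> Rintegral mu Itau f = F (2 * pi) - F 0.
Proof.
move=> hF cf; rewrite /Rintegral (@continuous_FTC2 _ f F) //.
- exact: pi2_gt0.
- by apply: continuous_subspaceT.
- have cF := is_derive_continuous hF.
  split.
  + by move=> x _; case: (hF x).
  + by apply: cvg_at_right_filter; exact: cF.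
  + by apply: cvg_at_left_filter; exact: cF.
- by move=> x _; rewrite derive1E; case: (hF x).
Qed.

Lemma cint_FTC (G g dg : R -> C) : (forall x, cder G x (g x)) ->
  (forall x, cder g x (dg x)) -> cint02pi g = G (2 * pi) - G 0.
Proof.
move=> hG /cder_continuous[c1 c2]; rewrite /cint02pi.
rewrite (Rintegral_FTC (fun x => proj1 (hG x)) c1).
rewrite (Rintegral_FTC (fun x => proj2 (hG x)) c2).
by rewrite -ReB -ImB; symmetry; exact: complexE.
Qed.

Lemma integrable_continuous (f : R -> R) : continuous f -> mu.-integrable Itau (EFin \o f).
Proof.
move=> cf; apply: continuous_compact_integrable; first exact: segment_compact.
exact: continuous_subspaceT.
Qed.

Lemma Rintegral_close (f g : R -> R) (e : R) : continuous f -> continuous g ->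
  (forall t, `|f t - g t| <= e) ->
  `|Rintegral mu Itau f - Rintegral mu Itau g| <= e * (2 * pi).
Proof.
move=> cf cg h; rewrite -RintegralB //; try exact: integrable_continuous.
have cfg : continuous (fun t => f t - g t).
  by move=> t; apply: cvgB; [exact: cf|exact: cg].
apply: le_trans (le_normr_Rintegral _ _) _ => //.
  exact: (integrable_continuous cfg).
apply: (@le_trans _ _ (Rintegral mu Itau (fun=> e))).
  apply: le_Rintegral => //.
  - apply: (@integrable_continuous (fun t => `|f t - g t|)) => t.
    exact: (cvg_norm (cfg t)).
  - by apply: integrable_continuous => t; exact: cvg_cst.
have hm : mu Itau = (2 * pi)%:E.
  by rewrite lebesgue_measure_itv /= lte_fin pi2_gt0 -EFinB subr0.
by rewrite Rintegral_cst // -[X in X <= _]/(e * fine (mu Itau)) hm.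
Qed.

Lemma continuous_approx (f : R -> R) :
  (forall e, 0 < e -> exists2 g : R -> R, continuous g & forall t, `|f t - g t| <= e) ->
  continuous f.
Proof.
move=> h x; apply/cvgrPdist_le => e e0.
have [|g cg hg] := h (e / 3); first lra.
have /cvgrPdist_le /(_ (e / 3)) : (g t @[t --> x] --> g x)%classic by exact: cg.
case; first lra.
move=> d d0 hd; exists d => // t /hd /= gt.
have := hg x; have := hg t.
have -> : f x - f t = (f x - g x) + (g x - g t) - (f t - g t) by ring.
move=> h1 h2; apply: le_trans (ler_normB _ _) _.
have := ler_normD (f x - g x) (g x - g t); lra.
Qed.

Lemma poly_primitive (q : {poly C}) : exists Q : {poly C}, Q^`() = q.
Proof.
exists (\poly_(i < (size q).+1) (q`_i.-1 / i%:R)); apply/polyP => i.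
rewrite coef_deriv coef_poly ltnS /=.
case: ltnP => h; last by rewrite mul0rn nth_default.
by rewrite -mulrnAr -(mulr_natr (_^-1)) mulVf ?mulr1 // pnatr_eq0.
Qed.

(** Along the circle [dz/dt = i z], so with [p = q X + c] the integrand is the derivative of
    [Q(z) + i c t], where [Q' = q]. The first term is periodic; only the constant coefficient
    survives. *)
Lemma mean_value_poly (p : {poly C}) (r : R) :
  cint02pi (fun t => 'i%C * p.[cR r * cexpi t]) = 2 * cR pi * 'i%C * p.[0].
Proof.
have hz x : cder (fun t => cR r * cexpi t) x ('i%C * (cR r * cexpi x)).
  apply: cder_eq; first exact: cderM (cder_cst _ _) (cder_cexpi x).
  by rewrite mul0r add0r mulrCA.
have [q [c pE]] : exists q c, p = q * 'X + c%:P.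
  by elim/poly_ind: p => [|q c _]; [exists 0, 0; rewrite mul0r addr0|exists q, c].
have [Q QE] := poly_primitive q.
rewrite (@cint_FTC (fun t => Q.[cR r * cexpi t] + 'i%C * c * cR t) _
  (fun x => 'i%C * (p^`().[cR r * cexpi x] * ('i%C * (cR r * cexpi x))))).
- have -> : cexpi (2 * pi) = 1 :> C.
    by rewrite /cexpi mulr_natl cos2pi sin2pi.
  have -> : cexpi 0 = 1 :> C by rewrite /cexpi cos0 sin0.
  have -> : cR (2 * pi) = 2 * cR pi :> C by rewrite cRM cR_nat.
  by rewrite pE hornerMXaddC cR0; ring.
- move=> x; apply: cder_eq.
    apply: cderD; first exact: cder_poly (hz x).
    exact: cderM (cder_cst _ _) (cder_id x).
  by rewrite QE pE hornerMXaddC; ring.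
- move=> x; apply: cder_eq; first exact: cderM (cder_cst _ _) (cder_poly p (hz x)).
  by rewrite mul0r add0r.
Qed.

Lemma cnorm_i : cnorm ('i%C : C) = 1.
Proof. by rewrite /cnorm /= expr0n expr1n add0r sqrtr1. Qed.

Lemma cnorm_cexpi x : cnorm (cexpi x) = 1 :> R.
Proof. by rewrite /cnorm /= cos2Dsin2 sqrtr1. Qed.

(** The lone factor [i] is what remains of [dmu = i z dt] after [z] has been absorbed into the
    simple pole: [h] stands for [z] times the singular function. *)
Lemma mean_value (h : C -> C) : uapprox h -> exists2 r0 : R, 0 < r0 &
  forall r : R, 0 < r < r0 ->
    (2 * cR pi * 'i%C)^-1 * cint02pi (fun t => 'i%C * h (cR r * cexpi t)) = h 0.
Proof.
move=> [rho rho0 hh]; exists rho => // r /andP[r0 rr].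
have zr t : cnorm (cR r * cexpi t) <= rho.
  by rewrite cnormM cnorm_cexpi mulr1 cnorm_cR gtr0_norm // ltW.
pose f t : C := 'i%C * h (cR r * cexpi t).
have happ e : 0 < e -> exists p : {poly C},
    forall t, cnorm (f t - 'i%C * p.[cR r * cexpi t]) <= e.
  move=> /hh[p hp]; exists p => t.
  by rewrite -mulrBr cnormM cnorm_i mul1r hp.
have cp (p : {poly C}) : continuous (fun t => complex.Re ('i%C * p.[cR r * cexpi t])) /\
    continuous (fun t => complex.Im ('i%C * p.[cR r * cexpi t])).
  apply: (@cder_continuous _
   (fun x => 'i%C * (p^`().[cR r * cexpi x] * (cR r * ('i%C * cexpi x))))) => x.
  apply: cder_eq.
    apply: cderM (cder_cst _ _) (cder_poly p _).
    exact: cderM (cder_cst _ _) (cder_cexpi x).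
  by rewrite !mul0r !add0r.
have cf1 : continuous (fun t => complex.Re (f t)).
  apply: continuous_approx => e /happ[p hp].
  exists (fun t => complex.Re ('i%C * p.[cR r * cexpi t])); first by case: (cp p).
  by move=> t; rewrite -ReB (le_trans (cnorm_Re _)) ?hp.
have cf2 : continuous (fun t => complex.Im (f t)).
  apply: continuous_approx => e /happ[p hp].
  exists (fun t => complex.Im ('i%C * p.[cR r * cexpi t])); first by case: (cp p).
  by move=> t; rewrite -ImB (le_trans (cnorm_Im _)) ?hp.
have pi0 : cR pi != 0 :> C.
  by apply/eqP => -[] /eqP; rewrite gt_eqF ?pi_gt0.
have i0 : 'i%C != 0 :> C by rewrite -cnorm_eq0 cnorm_i oner_eq0.
have k0 : 2 * cR pi * 'i%C != 0 :> C by rewrite !mulf_neq0 // pnatr_eq0.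
apply: (mulfI k0); rewrite mulrA divff // mul1r.
apply/eqP; rewrite -subr_eq0; apply/eqP; apply: cnorm_eq0_eps => e e0.
have pi0' := @pi_gt0 R.
(* Half of [e] pays for the integrals, whose difference is at most [e' * 2 pi] for each of the real
   and imaginary parts; the other half pays for the term at 0, multiplied by [|2 pi i|]. *)
pose e' := Num.min (e / (8 * pi)) (e / 2 / cnorm (2 * cR pi * 'i%C : C)).
have nk0 : 0 < cnorm (2 * cR pi * 'i%C : C) by rewrite lt0r cnorm_eq0 k0 cnorm_ge0.
have e'0 : 0 < e'.
  by rewrite lt_min !divr_gt0 //; lra.
have [p0 hp0] := hh _ e'0.
have hp t : cnorm (f t - 'i%C * p0.[cR r * cexpi t]) <= e'.
  by rewrite -mulrBr cnormM cnorm_i mul1r hp0.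
rewrite -[cint02pi _](subrK (cint02pi (fun t => 'i%C * p0.[cR r * cexpi t]))).
rewrite {2}mean_value_poly -addrA -mulrBr.
apply: le_trans (cnormD _ _) _; rewrite cnormM [cnorm (p0.[0] - _)]cdistC.
have h2 : cnorm (h 0 - p0.[0]) <= e'.
  by apply: hp0; rewrite cnorm0 ltW.
have h1 : cnorm (cint02pi f - cint02pi (fun t => 'i%C * p0.[cR r * cexpi t]))
    <= 2 * (e' * (2 * pi)).
  set a := cint02pi f; set b := cint02pi _.
  have [cp1 cp2] := cp p0.
  apply: le_trans (cnorm_le _) _; rewrite ReB ImB mulr_natl mulr2n.
  have ReE (g : R -> C) : complex.Re (cint02pi g) = Rintegral mu Itau (fun t => complex.Re (g t)).
    by rewrite /cint02pi ReD ReM /= !mul0r mulr0 !subr0 addr0.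
  have ImE (g : R -> C) : complex.Im (cint02pi g) = Rintegral mu Itau (fun t => complex.Im (g t)).
    by rewrite /cint02pi ImD ImM /= !mul0r mul1r !add0r.
  rewrite /a /b !ReE !ImE; apply: lerD; apply: Rintegral_close => // t.
    by rewrite -ReB (le_trans (cnorm_Re _)) ?hp.
  by rewrite -ImB (le_trans (cnorm_Im _)) ?hp.
have e1 : e' <= e / (8 * pi) by rewrite /e' ge_min lexx.
have e2 : e' <= e / 2 / cnorm (2 * cR pi * 'i%C : C) by rewrite /e' ge_min lexx orbT.
rewrite ler_pdivlMr // in e2; rewrite ler_pdivlMr in e1; last lra.
have := ler_wpM2l (ltW nk0) h2; move: h1; rewrite /f; lra.
Qed.

End ComplexDerivative.

(** * Complex power series *)

Section ComplexSeries.
Variable R : realType.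
Local Notation C := R[i].
Implicit Types (w : nat -> C) (S : C).

Definition is_csum w S : Prop :=
  (series (fun n => complex.Re (w n)) @ \oo --> complex.Re S)%classic /\
  (series (fun n => complex.Im (w n)) @ \oo --> complex.Im S)%classic.

Definition csum w : C :=
  Complex (limn (series (fun n => complex.Re (w n))))
          (limn (series (fun n => complex.Im (w n)))).

Lemma is_csum_unique w S S' : is_csum w S -> is_csum w S' -> S = S'.
Proof.
move=> [h1 h2] [h1' h2']; apply/eqP; rewrite eq_complex.
by rewrite (cvg_unique _ h1 h1') // (cvg_unique _ h2 h2') // !eqxx.
Qed.

Lemma is_csum_ext w w' S : w =1 w' -> is_csum w S -> is_csum w' S.
Proof. by move=> /funext ->. Qed.

Lemma seriesD' (f g : nat -> R) : series (fun n => f n + g n) =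
  (fun n => series f n + series g n).
Proof. by apply/funext => n; rewrite /series /= big_split. Qed.

Lemma seriesZ' (k : R) (f : nat -> R) : series (fun n => k * f n) =
  (fun n => k * series f n).
Proof. by apply/funext => n; rewrite /series /= mulr_sumr. Qed.

Lemma is_csumD w w' S S' : is_csum w S -> is_csum w' S' ->
  is_csum (fun n => w n + w' n) (S + S').
Proof.
move=> [h1 h2] [h1' h2']; split.
  rewrite ReD (_ : (fun n => _) = (fun n => complex.Re (w n) + complex.Re (w' n))).
    by rewrite seriesD'; exact: cvgD.
  by apply/funext => n; rewrite ReD.
rewrite ImD (_ : (fun n => _) = (fun n => complex.Im (w n) + complex.Im (w' n))).
  by rewrite seriesD'; exact: cvgD.
by apply/funext => n; rewrite ImD.
Qed.

Lemma is_csumZ (c : C) w S : is_csum w S -> is_csum (fun n => c * w n) (c * S).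
Proof.
move=> [h1 h2]; split.
  rewrite ReM (_ : (fun n => _) = (fun n => complex.Re c * complex.Re (w n)
     + (- complex.Im c) * complex.Im (w n))).
    rewrite seriesD' !seriesZ' -mulNr.
    by apply: cvgD; apply: cvgM => //; exact: cvg_cst.
  by apply/funext => n; rewrite ReM mulNr.
rewrite ImM (_ : (fun n => _) = (fun n => complex.Re c * complex.Im (w n)
     + complex.Im c * complex.Re (w n))).
  rewrite seriesD' !seriesZ'.
  by apply: cvgD; apply: cvgM => //; exact: cvg_cst.
by apply/funext => n; rewrite ImM.
Qed.

Lemma is_csum_head w : (forall k, w k.+1 = 0) -> is_csum w (w 0%N).
Proof.
move=> h.
have hs (f : nat -> R) : (forall k, f k.+1 = 0) -> (series f @ \oo --> f 0%N)%classic.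
  move=> hf; apply/cvgrPdist_le => e e0; exists 1%N => // -[//|n] _.
  rewrite /series /= big_nat_recl // big1 ?addr0; last by move=> i _; exact: hf.
  by rewrite subrr normr0 ltW.
by split; [apply: (hs (fun n => complex.Re (w n)))|apply: (hs (fun n => complex.Im (w n)))];
  move=> k; rewrite h.
Qed.

Lemma is_csum_shift w S : w 0%N = 0 -> is_csum (fun n => w n.+1) S -> is_csum w S.
Proof.
move=> w0.
have hs (f : nat -> R) (l : R) : f 0%N = 0 ->
    (series (fun n => f n.+1) @ \oo --> l)%classic -> (series f @ \oo --> l)%classic.
  move=> f0; rewrite -(cvg_shiftS (series f)).
  suff -> : series (fun n => f n.+1) = (fun n => series f n.+1) by [].
  by apply/funext => n; rewrite /series /= big_nat_recl // f0 add0r.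
move=> [h1 h2]; split.
  by apply: (hs (fun n => complex.Re (w n))) => //; rewrite w0.
by apply: (hs (fun n => complex.Im (w n))) => //; rewrite w0.
Qed.

Lemma series_dominated (f u : nat -> R) : (forall n, `|f n| <= u n) ->
  cvgn (series u) -> cvgn (series f).
Proof.
move=> h cu; apply: normed_cvg.
apply: (series_le_cvg _ _ _ cu) => n /=; rewrite ?normr_ge0 ?h //.
exact: le_trans (normr_ge0 _) (h n).
Qed.

Lemma csum_dominated w (u : nat -> R) : (forall n, cnorm (w n) <= u n) ->
  cvgn (series u) -> is_csum w (csum w).
Proof.
move=> h cu; split.
  by apply: (series_dominated _ cu) => n; apply: le_trans (cnorm_Re _) (h n).
by apply: (series_dominated _ cu) => n; apply: le_trans (cnorm_Im _) (h n).
Qed.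

Lemma series_tail (f u : nat -> R) (l : R) N : (forall n, `|f n| <= u n) ->
  cvgn (series u) -> (series f @ \oo --> l)%classic ->
  `|l - series f N| <= limn (series u) - series u N.
Proof.
move=> h cu hl.
have hM M : (N <= M)%N -> `|series f M - series f N| <= limn (series u) - series u N.
  move=> NM; apply: (@le_trans _ _ (series u M - series u N)).
    rewrite !sub_series NM.
    by apply: le_trans (ler_norm_sum _ _ _) _; apply: ler_sum => i _.
  rewrite lerD2r; apply: nondecreasing_cvgn_le => //.
  apply: nondecreasing_series => i _ _; exact: le_trans (normr_ge0 _) (h i).
have hl' : (`|series f M - series f N| @[M --> \oo] --> `|l - series f N|)%classic.
  by apply: cvg_norm; apply: cvgB => //; exact: cvg_cst.
rewrite -(cvg_lim _ hl') //; apply: limr_le.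
  by apply/cvg_ex; exists (`|l - series f N|).
by exists N => // M /= NM; exact: hM.
Qed.

Lemma csum_tail w S (u : nat -> R) N : (forall n, cnorm (w n) <= u n) ->
  cvgn (series u) -> is_csum w S ->
  cnorm (S - \sum_(0 <= i < N) w i) <= 2 * (limn (series u) - series u N).
Proof.
move=> h cu [h1 h2].
apply: le_trans (cnorm_le _) _; rewrite mulr_natl mulr2n ReB ImB.
have ReS n : complex.Re (\sum_(0 <= i < n) w i) = series (fun n => complex.Re (w n)) n.
  by elim: n => [|n IH]; rewrite /series /= ?big_nil // !big_nat_recr //= ReD IH.
have ImS n : complex.Im (\sum_(0 <= i < n) w i) = series (fun n => complex.Im (w n)) n.
  by elim: n => [|n IH]; rewrite /series /= ?big_nil // !big_nat_recr //= ImD IH.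
rewrite ReS ImS; apply: lerD; apply: series_tail => // n.
  exact: le_trans (cnorm_Re _) (h n).
exact: le_trans (cnorm_Im _) (h n).
Qed.

Lemma uapprox_csum (p : nat -> {poly C}) (u : nat -> R) :
  (forall n z, cnorm z <= 1 -> cnorm (p n).[z] <= u n) -> cvgn (series u) ->
  uapprox (fun z => csum (fun n => (p n).[z])).
Proof.
move=> h cu; exists 1 => // e e0.
have /cvgrPdist_le /(_ (e / 2)) : (series u @ \oo --> limn (series u))%classic by [].
case; first lra.
move=> N _ /(_ N (leqnn N)) /= hN.
exists (\sum_(0 <= i < N) p i) => z hz.
have hz' n := h n z hz.
rewrite horner_sum.
have := csum_tail N hz' cu (csum_dominated hz' cu).
have := ler_norm (limn (series u) - series u N); lra.
Qed.

(** Coefficient bound [K M^k / k!] of an entire function of exponential type. Termwise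
    differentiation only replaces [K] by [K M], so the class is stable under it. *)
Definition exp_bounded (a : nat -> C) : Prop := exists K M : R,
  [/\ 0 <= K, 0 <= M & forall k, cnorm (a k) <= K * exp_coeff M k].

Definition cpseries (a : nat -> C) (x : R) : C := csum (fun k => a k * cR x ^+ k).

Definition cdiffs (a : nat -> C) (k : nat) : C := k.+1%:R * a k.+1.

Lemma cnorm_nat n : cnorm (n%:R : C) = n%:R.
Proof. by rewrite -cR_nat cnorm_cR normr_nat. Qed.

Lemma cvg_exp_coeffZ (K M : R) : cvgn (series (fun k => K * exp_coeff M k)).
Proof.
by rewrite seriesZ'; apply: is_cvgM; [exact: is_cvg_cst|exact: is_cvg_series_exp_coeff].
Qed.

Lemma exp_bounded_diffs a : exp_bounded a -> exp_bounded (cdiffs a).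
Proof.
move=> [K [M [K0 M0 h]]]; exists (K * M), M; split=> //; first exact: mulr_ge0.
move=> k; rewrite cnormM cnorm_nat.
apply: le_trans (ler_wpM2l _ (h k.+1)) _ => //.
rewrite /exp_coeff /= factS natrM exprS.
have h1 : k.+1%:R != 0 :> R by rewrite pnatr_eq0.
have h2 : k`!%:R != 0 :> R by rewrite pnatr_eq0 -lt0n fact_gt0.
suff -> : k.+1%:R * (K * (M * M ^+ k / (k.+1%:R * k`!%:R))) =
  K * M * (M ^+ k / k`!%:R) by [].
by move: (k.+1%:R) (k`!%:R) h1 h2 => a1 a2 h1 h2; field; rewrite h1 h2.
Qed.

Lemma exp_bounded_summable a x : exp_bounded a -> exists2 u : nat -> R,
  cvgn (series u) & forall k, cnorm (a k * cR x ^+ k) <= u k.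
Proof.
move=> [K [M [K0 M0 h]]]; exists (fun k => K * exp_coeff (M * `|x|) k).
  exact: cvg_exp_coeffZ.
move=> k; rewrite cnormM cnormX cnorm_cR.
apply: le_trans (ler_wpM2r _ (h k)) _; first by rewrite exprn_ge0.
by rewrite /exp_coeff /= exprMn -!mulrA ler_wpM2l // ler_wpM2l ?exprn_ge0 // mulrC.
Qed.

Lemma is_csum_cpseries a x : exp_bounded a ->
  is_csum (fun k => a k * cR x ^+ k) (cpseries a x).
Proof.
by move=> /(exp_bounded_summable x)[u cu hu]; exact: csum_dominated hu cu.
Qed.

Lemma cder_cpseries a x : exp_bounded a ->
  cder (cpseries a) x (cpseries (cdiffs a) x).
Proof.
move=> ha.
have hb := exp_bounded_diffs ha; have hc := exp_bounded_diffs hb.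
have ReE (a' : nat -> C) y : (fun k => complex.Re (a' k * cR y ^+ k)) =
    (fun k => complex.Re (a' k) * y ^+ k).
  by apply/funext => k; rewrite ReM -cRX /= mulr0 subr0.
have ImE (a' : nat -> C) y : (fun k => complex.Im (a' k * cR y ^+ k)) =
    (fun k => complex.Im (a' k) * y ^+ k).
  by apply/funext => k; rewrite ImM -cRX /= mulr0 add0r.
have ReN (a' : nat -> C) k : complex.Re (cdiffs a' k) = k.+1%:R * complex.Re (a' k.+1).
  by rewrite /cdiffs -cR_nat ReM /= mul0r subr0.
have ImN (a' : nat -> C) k : complex.Im (cdiffs a' k) = k.+1%:R * complex.Im (a' k.+1).
  by rewrite /cdiffs -cR_nat ImM /= mul0r addr0.
have RecvgP (a' : nat -> C) y : exp_bounded a' -> cvgn (pseries (fun k => complex.Re (a' k)) y).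
  move=> /(is_csum_cpseries y)[h _]; apply/cvg_ex; eexists.
  by rewrite /pseries -ReE; exact: h.
have ImcvgP (a' : nat -> C) y : exp_bounded a' -> cvgn (pseries (fun k => complex.Im (a' k)) y).
  move=> /(is_csum_cpseries y)[_ h]; apply/cvg_ex; eexists.
  by rewrite /pseries -ImE; exact: h.
have Rediff (a' : nat -> C) : pseries_diffs (fun k => complex.Re (a' k)) =
    (fun k => complex.Re (cdiffs a' k)).
  by apply/funext => k; rewrite ReN.
have Imdiff (a' : nat -> C) : pseries_diffs (fun k => complex.Im (a' k)) =
    (fun k => complex.Im (cdiffs a' k)).
  by apply/funext => k; rewrite ImN.
have hx : `|x| < `|(`|x| + 1)| by rewrite [ltRHS]ger0_norm ?addr_ge0 // ltrDl.
split.
- rewrite (_ : (fun t => _) = (fun y => limn (pseries (fun k => complex.Re (a k)) y))).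
    rewrite [complex.Re (cpseries _ _)]/= ReE.
    rewrite -[X in limn X]/(pseries (fun k => complex.Re (cdiffs a k)) x) -Rediff.
    apply: (@pseries_snd_diffs _ _ (`|x| + 1)) => //; rewrite ?Rediff; exact: RecvgP.
  by apply/funext => y; rewrite /cpseries /= ReE.
- rewrite (_ : (fun t => _) = (fun y => limn (pseries (fun k => complex.Im (a k)) y))).
    rewrite [complex.Im (cpseries _ _)]/= ImE.
    rewrite -[X in limn X]/(pseries (fun k => complex.Im (cdiffs a k)) x) -Imdiff.
    apply: (@pseries_snd_diffs _ _ (`|x| + 1)) => //; rewrite ?Imdiff; exact: ImcvgP.
  by apply/funext => y; rewrite /cpseries /= ImE.
Qed.

End ComplexSeries.

(** * Fundamental solutions of the edge equation *)

Section FundamentalSolutions.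
Variable R : realType.
Local Notation C := R[i].
Implicit Types (mu lam z : C) (x : R) (b : bool).

(** The flag [b] is the parity of the series in [x]. The half index [k./2] counts powers of [mu]
    itself, so no square root is chosen and the solutions are entire in [mu]. *)
Definition fcoef b mu k : C := if odd k == b then (- mu) ^+ k./2 / k`!%:R else 0.

(* [fsol false mu x = cos (sqrt mu x)] and [fsol true mu x = sin (sqrt mu x) / sqrt mu]. *)
Definition fsol b mu x : C := cpseries (fcoef b mu) x.

(** The quotient of [(- lam - z)^n - (- lam)^n] by [- z], written without division. Consequently
    [qsol] is the divided difference of [fsol] in [mu], and at [z = 0] its derivative. *)
Definition qpow lam z n : C := \sum_(i < n) (- lam - z) ^+ (n.-1 - i) * (- lam) ^+ i.

Definition qcoef b lam z k : C := if odd k == b then - qpow lam z k./2 / k`!%:R else 0.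

Definition qsol b lam x z : C := cpseries (qcoef b lam z) x.

Lemma fact_neq0 k : k`!%:R != 0 :> C.
Proof. by rewrite pnatr_eq0 -lt0n fact_gt0. Qed.

Lemma exp_bounded_fcoef b mu : exp_bounded (fcoef b mu).
Proof.
exists 1, (1 + cnorm mu); split=> //; first by rewrite addr_ge0 ?cnorm_ge0.
move=> k; rewrite mul1r /fcoef /exp_coeff /=.
have B0 : 0 <= 1 + cnorm mu by rewrite addr_ge0 ?cnorm_ge0.
case: ifP => _; last by rewrite cnorm0 mulr_ge0 ?exprn_ge0 ?invr_ge0.
rewrite cnormM cnormV cnorm_nat ler_wpM2r ?invr_ge0 // cnormX cnormN.
apply: (@le_trans _ _ ((1 + cnorm mu) ^+ k./2)).
  by rewrite lerXn2r ?nnegrE ?cnorm_ge0 //; lra.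
apply: ler_weXn2l; first by have := cnorm_ge0 mu; lra.
by lia.
Qed.

Lemma exp_bounded_qcoef_unif b lam : exists2 M : R, 0 <= M &
  forall z k, cnorm z <= 1 -> cnorm (qcoef b lam z k) <= 1 * exp_coeff M k.
Proof.
have l0 := cnorm_ge0 lam.
(* On the unit disc [B >= 1] dominates both [- lam - z] and [- lam]; the extra factor 2 absorbs the
   number of summands, as [k./2 <= 2^k]. *)
pose B := 2 + cnorm lam; exists (2 * B); first by rewrite /B; lra.
move=> z k hz; rewrite mul1r /qcoef /exp_coeff /=.
have B1 : 1 <= B by rewrite /B; lra.
have B0 : 0 <= B by lra.
case: ifP => _; last by rewrite cnorm0 mulr_ge0 ?exprn_ge0 ?invr_ge0 //; lra.
rewrite cnormM cnormV cnorm_nat ler_wpM2r ?invr_ge0 // cnormN.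
apply: le_trans (cnorm_sum _ _ _) _.
apply: (@le_trans _ _ (\sum_(i < k./2) B ^+ k)).
  apply: ler_sum => i _; rewrite cnormM !cnormX cnormN.
  apply: (@le_trans _ _ (B ^+ (k./2.-1 - i) * B ^+ i)).
    apply: ler_pM; rewrite ?exprn_ge0 ?cnorm_ge0 // lerXn2r ?nnegrE ?cnorm_ge0 //.
      by have := cnormB (- lam) z; rewrite cnormN /B; lra.
    by rewrite /B; lra.
  by rewrite -exprD ler_weXn2l //; have := ltn_ord i; lia.
rewrite sumr_const card_ord -(mulr_natl (B ^+ k)) exprMn ler_wpM2r ?exprn_ge0 //.
rewrite -natrX ler_nat.
by apply: leq_trans (ltnW (ltn_expl k (ltnSn 1))); lia.
Qed.

Lemma exp_bounded_qcoef b lam z : cnorm z <= 1 -> exp_bounded (qcoef b lam z).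
Proof.
move=> hz; have [M M0 h] := exp_bounded_qcoef_unif b lam.
by exists 1, M; split=> // k; exact: h.
Qed.

Lemma fcoef_qcoef b lam z k :
  fcoef b (lam + z) k = fcoef b lam k + z * qcoef b lam z k.
Proof.
rewrite /fcoef /qcoef; case: ifP => _; last by rewrite mulr0 addr0.
have : (- (lam + z)) ^+ k./2 - (- lam) ^+ k./2 = - z * qpow lam z k./2.
  by rewrite opprD subrXX; congr (_ * _); ring.
move=> /eqP; rewrite subr_eq => /eqP ->; ring.
Qed.

Lemma fsol_qsol b lam x z : cnorm z <= 1 ->
  fsol b (lam + z) x = fsol b lam x + z * qsol b lam x z.
Proof.
move=> hz.
have h1 := is_csum_cpseries x (exp_bounded_fcoef b (lam + z)).
have h2 := is_csum_cpseries x (exp_bounded_fcoef b lam).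
have h3 := is_csum_cpseries x (exp_bounded_qcoef b lam hz).
apply: (is_csum_unique h1); apply: is_csum_ext (is_csumD h2 (is_csumZ z h3)) => k.
by rewrite fcoef_qcoef mulrDl mulrA.
Qed.

(** Each term is a polynomial in [z] with a summable bound independent of [z] in the unit disc, so
    the partial sums are the required approximants. *)
Lemma uapprox_qsol b lam x : uapprox (qsol b lam x).
Proof.
pose qp n : {poly C} :=
  \sum_(i < n) ((- lam)%:P - 'X) ^+ (n.-1 - i) * ((- lam) ^+ i)%:P.
pose p k : {poly C} :=
  if odd k == b then (- (cR x ^+ k / k`!%:R))%:P * qp k./2 else 0.
have pE k z : (p k).[z] = qcoef b lam z k * cR x ^+ k.
  rewrite /p /qcoef; case: ifP => _; last by rewrite horner0 mul0r.
  rewrite hornerM hornerC horner_sum /qpow.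
  under eq_bigr do rewrite hornerM horner_exp hornerD hornerN hornerX !hornerC.
  by ring.
have [M M0 h] := exp_bounded_qcoef_unif b lam.
apply: (@uapprox_ext _ (fun z => csum (fun n => (p n).[z])) _ 1); first exact: ltr01.
  by move=> z _; rewrite /qsol /cpseries; congr csum; apply/funext => k; rewrite pE.
apply: (@uapprox_csum _ _ (fun k => 1 * exp_coeff (M * `|x|) k)); last first.
  exact: cvg_exp_coeffZ.
move=> k z hz; rewrite pE cnormM cnormX cnorm_cR.
apply: le_trans (ler_wpM2r _ (h z k hz)) _; first by rewrite exprn_ge0.
by rewrite /exp_coeff /= exprMn !mul1r -!mulrA ler_wpM2l ?exprn_ge0 // mulrC.
Qed.

Lemma qpow0 lam n : qpow lam 0 n = n%:R * (- lam) ^+ n.-1.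
Proof.
rewrite /qpow subr0.
under eq_bigr => i _.
  rewrite -exprD (_ : (n.-1 - i + i)%N = n.-1); last by have := ltn_ord i; lia.
  over.
by rewrite sumr_const card_ord mulr_natl.
Qed.

(** The derivative of [cos (sqrt mu x)] with respect to [mu], obtained by comparing coefficients.
    Such closed forms are what turns the first-order pairing into an explicit energy. *)
Lemma qsol0_cos lam x : qsol false lam x 0 = - (cR x / 2) * fsol true lam x.
Proof.
have z1 : cnorm (0 : C) <= 1 by rewrite cnorm0.
have h1 := is_csum_cpseries x (exp_bounded_qcoef false lam z1).
have h2 := is_csum_cpseries x (exp_bounded_fcoef true lam).
apply: (is_csum_unique h1); apply: is_csum_shift.
  by rewrite /qcoef /= qpow0 mul0r oppr0 !mul0r.
apply: is_csum_ext (is_csumZ _ h2) => k.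
rewrite /qcoef /fcoef /= eqbF_neg negbK eqb_id; case: ifP => ok; last first.
  by rewrite !mul0r mulr0.
rewrite qpow0 uphalf_half ok /= factS natrM exprS.
have -> : k.+1%:R = 2 * (1 + k./2)%:R :> C.
  rewrite -natrM; congr (_%:R); have := odd_double_half k; rewrite ok; lia.
have h : (1 + k./2)%:R != 0 :> C by rewrite pnatr_eq0.
have := fact_neq0 k; move: (k`!%:R) h => f; rewrite add1n /=.
move: (_.+1%:R) => a a0 f0.
by field; rewrite f0 a0.
Qed.

(** The derivative of [sin (sqrt mu x) / sqrt mu] with respect to [mu], cleared of its denominator
    [2 mu]. *)
Lemma qsol0_sin lam x :
  2 * lam * qsol true lam x 0 = cR x * fsol false lam x - fsol true lam x.
Proof.
have z1 : cnorm (0 : C) <= 1 by rewrite cnorm0.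
have h1 := is_csum_cpseries x (exp_bounded_qcoef true lam z1).
have h2 := is_csum_cpseries x (exp_bounded_fcoef true lam).
have h3 := is_csum_cpseries x (exp_bounded_fcoef false lam).
apply/eqP; rewrite eq_sym subr_eq eq_sym; apply/eqP.
apply: (is_csum_unique (is_csumD (is_csumZ (2 * lam) h1) h2)).
apply: is_csum_shift; first by rewrite /qcoef /fcoef /= !mul0r mulr0 addr0.
apply: is_csum_ext (is_csumZ _ h3) => k.
rewrite /qcoef /fcoef /= eqb_id eqbF_neg; case: ifP => ok; last first.
  by rewrite !mul0r !mulr0 addr0.
rewrite qpow0 uphalf_half (negbTE ok) /= add0n factS natrM exprS.
have k0 : k.+1%:R != 0 :> C by rewrite pnatr_eq0.
have kE : k.+1%:R = 2 * k./2%:R + 1 :> C.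
  rewrite -natrM natr1; congr (_%:R); have := odd_double_half k.
  by rewrite (negbTE ok); lia.
(* For [k./2 = 0] the truncated predecessor gives the wrong exponent, but the factor [k./2] makes
   both sides zero. *)
have e : (- lam) ^+ k./2 * (2 * k./2%:R) = - (2 * lam * (k./2%:R * (- lam) ^+ k./2.-1)).
  by case: (k./2) => [|n]; rewrite ?mulr0 ?mul0r ?mulr0 ?oppr0 //= exprS; ring.
have := fact_neq0 k; move: (k`!%:R) => f f0.
have -> : 2 * lam * (- (k./2%:R * (- lam) ^+ k./2.-1) / (k.+1%:R * f) * (cR x * cR x ^+ k)) =
  - (2 * lam * (k./2%:R * (- lam) ^+ k./2.-1)) * ((k.+1%:R * f)^-1 * (cR x * cR x ^+ k)) by ring.
rewrite -e.
have -> : 2 * k./2%:R = k.+1%:R - 1 :> C by rewrite kE addrK.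
move: (k.+1%:R) k0 => a a0; move: (_ ^+ k./2) (_ ^+ k) => u v.
by field; rewrite f0 a0.
Qed.

Lemma fsol_at0 b mu : fsol b mu 0 = if b then 0 else 1.
Proof.
have h := is_csum_cpseries 0 (exp_bounded_fcoef b mu).
have h' : is_csum (fun k => fcoef b mu k * cR 0 ^+ k) (fcoef b mu 0 * cR 0 ^+ 0).
  by apply: is_csum_head => k; rewrite exprS mul0r mulr0.
rewrite /fsol (is_csum_unique h h') /fcoef /= expr0 mulr1.
by case: b {h h'} => //=; rewrite divr1.
Qed.

Lemma cder_cos mu x : cder (fsol false mu) x (- mu * fsol true mu x).
Proof.
apply: cder_eq; first exact: cder_cpseries (exp_bounded_fcoef false mu).
have h1 := is_csum_cpseries x (exp_bounded_diffs (exp_bounded_fcoef false mu)).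
have h2 := is_csum_cpseries x (exp_bounded_fcoef true mu).
apply: (is_csum_unique h1); apply: is_csum_ext (is_csumZ _ h2) => k.
rewrite /cdiffs /fcoef /= eqbF_neg negbK eqb_id; case: ifP => ok; last first.
  by rewrite !mul0r !mulr0 mul0r.
rewrite uphalf_half ok /= exprD expr1 factS natrM.
have k0 : k.+1%:R != 0 :> C by rewrite pnatr_eq0.
move: (k.+1%:R) k0 => a a0; have := fact_neq0 k; move: (k`!%:R) => f f0.
by field; rewrite f0 a0.
Qed.

Lemma cder_sin mu x : cder (fsol true mu) x (fsol false mu x).
Proof.
apply: cder_eq; first exact: cder_cpseries (exp_bounded_fcoef true mu).
have h1 := is_csum_cpseries x (exp_bounded_diffs (exp_bounded_fcoef true mu)).
have h2 := is_csum_cpseries x (exp_bounded_fcoef false mu).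
apply: (is_csum_unique h1); apply: is_csum_ext h2 => k.
rewrite /cdiffs /fcoef /= eqb_id eqbF_neg; case: ifP => ok; last first.
  by rewrite !mulr0 mul0r.
rewrite uphalf_half (negbTE ok) add0n factS natrM.
have k0 : k.+1%:R != 0 :> C by rewrite pnatr_eq0.
move: (k.+1%:R) k0 => a a0; have := fact_neq0 k; move: (k`!%:R) => f f0.
by field; rewrite f0 a0.
Qed.

End FundamentalSolutions.

(** * One-sided calculus on a closed interval and uniqueness for the edge equation *)

Section DerivOn.
Variable R : realType.
Local Notation C := R[i].
Implicit Types (a b x : R) (f g : R -> C).

Lemma deriv_onP a b f f' : deriv_on a b f f' <->
  forall x, a <= x <= b -> forall e, 0 < e -> exists2 d, 0 < d &
    forall h, h != 0 -> `|h| < d -> a <= x + h <= b ->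
      cnorm ((f (x + h) - f x) / cR h - f' x) <= e.
Proof.
split=> hf x xab.
- move=> e e0.
  have ce0 : 0 < cR e by rewrite ltcE /= eqxx.
  have /(@cvgrPdist_le C C^o) /(_ _ ce0) /nbhs_ballP [d d0 hd] := hf x xab.
  exists d => // h h0 hh hx.
  have := hd h; rewrite /ball /= sub0r normrN => /(_ hh (conj h0 hx)).
  by rewrite normr_cnorm lecE /= eqxx /= cdistC.
- apply/(@cvgrPdist_le C C^o) => e e0.
  have [eI eR] : complex.Im e = 0 /\ 0 < complex.Re e.
    by move: e0; rewrite ltcE => /andP[/eqP -> ?].
  have [d d0 hd] := hf x xab _ eR.
  apply/nbhs_ballP; exists d => // h; rewrite /ball /= sub0r normrN => hh [h0 hx].
  by rewrite normr_cnorm lecE /= eI eqxx /= cdistC; exact: hd.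
Qed.

Lemma deriv_on_ext a b f f' g g' :
  (forall x, a <= x <= b -> f x = g x) -> (forall x, a <= x <= b -> f' x = g' x) ->
  deriv_on a b f f' -> deriv_on a b g g'.
Proof.
move=> h h' /deriv_onP hf; apply/deriv_onP => x xab e e0.
have [d d0 hd] := hf x xab e e0; exists d => // k k0 kd kx.
by rewrite -h // -h // -h' //; exact: hd.
Qed.

Lemma deriv_on_cst a b (c : C) : deriv_on a b (fun=> c) (fun=> 0).
Proof.
apply/deriv_onP => x _ e e0; exists 1 => // h _ _ _.
by rewrite subrr mul0r subrr cnorm0 ltW.
Qed.

Lemma cvg_eqfun (f g : R -> C^o) (F : set_system R) (l : C^o) : f =1 g ->
  (f @ F --> l)%classic -> (g @ F --> l)%classic.
Proof. by move=> /funext ->. Qed.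

Lemma deriv_onD a b f f' g g' : deriv_on a b f f' -> deriv_on a b g g' ->
  deriv_on a b (fun x => f x + g x) (fun x => f' x + g' x).
Proof.
move=> hf hg x xab; set F := within _ _.
have FF : Filter F by apply: within_filter.
apply: cvg_eqfun (@cvgD C C^o _ F FF _ _ _ _ (hf x xab) (hg x xab)) => h /=.
rewrite -[LHS]/((f (x + h) - f x) / cR h + (g (x + h) - g x) / cR h).
by ring.
Qed.

Lemma deriv_on_cvg a b f f' x : deriv_on a b f f' -> a <= x <= b ->
  ((fun h : R => f (x + h) : C^o) @
     within (fun h : R => h != 0 /\ a <= x + h <= b) (nbhs (0 : R)) --> (f x : C^o))%classic.
Proof.
move=> hf xab; set F := within _ _.
have c0 : ((fun h : R => cR h : C^o) @ F --> (0 : C^o))%classic.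
  apply/(@cvgrPdist_le C C^o) => e e0.
  have [eI eR] : complex.Im e = 0 /\ 0 < complex.Re e.
    by move: e0; rewrite ltcE => /andP[/eqP -> ?].
  apply/nbhs_ballP; exists (complex.Re e) => // h.
  rewrite /ball /= sub0r normrN => hh _.
  by rewrite sub0r normrN normr_cnorm cnorm_cR lecE /= eI eqxx /= ltW.
have FF : Filter F by apply: within_filter.
have := @cvgD C C^o _ F FF _ _ _ _ (@cvg_cst C^o (f x) _ F FF)
  (@cvgM C _ F FF _ _ _ _ (hf x xab) c0).
rewrite mulr0 addr0; apply: cvg_eqfun => h.
rewrite -[LHS]/(f x + (f (x + h) - f x) / cR h * cR h).
have [->|h0] := eqVneq h 0; first by rewrite addr0 subrr !mul0r addr0.
by rewrite divfK ?cR_eq0 // addrC subrK.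
Qed.

Lemma deriv_onM a b f f' g g' : deriv_on a b f f' -> deriv_on a b g g' ->
  deriv_on a b (fun x => f x * g x) (fun x => f' x * g x + f x * g' x).
Proof.
move=> hf hg x xab; set F := within _ _.
have FF : Filter F by apply: within_filter.
have h1 := @cvgM C _ F FF _ _ _ _ (hf x xab) (deriv_on_cvg hg xab).
have h2 := @cvgM C _ F FF _ _ _ _ (@cvg_cst C^o (f x) _ F FF) (hg x xab).
apply: cvg_eqfun (@cvgD C C^o _ F FF _ _ _ _ h1 h2) => h.
rewrite -[LHS]/((f (x + h) - f x) / cR h * g (x + h) + f x * ((g (x + h) - g x) / cR h)).
by ring.
Qed.

Lemma deriv_onZ a b (c : C) f f' : deriv_on a b f f' ->
  deriv_on a b (fun x => c * f x) (fun x => c * f' x).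
Proof.
move=> /(deriv_onM (deriv_on_cst c)); apply: deriv_on_ext => // x _.
by rewrite mul0r add0r.
Qed.

Lemma is_derive_eps (g : R -> R) x d : is_derive x 1 g d <->
  forall e, 0 < e -> exists2 r, 0 < r &
    forall h, h != 0 -> `|h| < r -> `|(g (x + h) - g x) / h - d| <= e.
Proof.
split.
- move=> [dg gE] e e0; rewrite /derivable in dg.
  have /cvgrPdist_le /(_ _ e0) /nbhs_ballP[r r0 hr] :
     (h^-1 *: (g (h *: 1 + x) - g x) @[h --> 0^'] --> d)%classic by rewrite -gE.
  exists r => // h h0 hh; have := hr h; rewrite /ball /= sub0r normrN => /(_ hh h0).
  by rewrite distrC /GRing.scale /= mulr1 (addrC h) (mulrC h^-1).
- move=> hg.
  suff c : (h^-1 *: (g (h *: 1 + x) - g x) @[h --> 0^'] --> d)%classic.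
    split; first by apply/cvg_ex; exists d.
    by apply: cvg_lim.
  apply/cvgrPdist_le => e e0; have [r r0 hr] := hg e e0.
  apply/nbhs_ballP; exists r => // h; rewrite /ball /= sub0r normrN => hh h0.
  by rewrite distrC /GRing.scale /= mulr1 (addrC h) (mulrC h^-1); exact: hr.
Qed.

Lemma cder_deriv_on a b f f' : (forall x, cder f x (f' x)) -> deriv_on a b f f'.
Proof.
move=> h; apply/deriv_onP => x _ e e0.
have e20 : 0 < e / 2 by lra.
have [/is_derive_eps /(_ _ e20)[r1 r10 h1] /is_derive_eps /(_ _ e20)[r2 r20 h2]] := h x.
exists (Num.min r1 r2); first by rewrite lt_min r10.
move=> k k0; rewrite lt_min => /andP[k1 k2] _.
apply: le_trans (cnorm_le _) _; rewrite !ReB !ImB -cRV ReM ImM /= !mulr0 !subr0 add0r ReB ImB.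
have := h1 k k0 k1; have := h2 k k0 k2; lra.
Qed.

(** Increments are restricted to the interval, so two-sided derivatives exist only inside it.
    Bounding the quotients by 1 near each point gives continuity up to the endpoints, after which
    the mean value theorem applies. *)
Lemma is_derive0_cst_on (g : R -> R) (b : R) : 0 < b ->
  (forall x, 0 <= x <= b -> forall e, 0 < e -> exists2 d, 0 < d &
    forall h, h != 0 -> `|h| < d -> 0 <= x + h <= b -> `|(g (x + h) - g x) / h| <= e) ->
  g b = g 0.
Proof.
move=> b0 hg.
have gc x : 0 <= x <= b -> forall e, 0 < e -> exists2 d, 0 < d &
    forall y, `|y - x| < d -> 0 <= y <= b -> `|g x - g y| <= e.
  move=> xb e e0; have [d d0 hd] := hg x xb 1 ltr01.
  exists (Num.min d e); first by rewrite lt_min d0.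
  move=> y; rewrite lt_min => /andP[yd ye] yb.
  have [->|yx] := eqVneq y x; first by rewrite subrr normr0 ltW.
  have yx0 : y - x != 0 by rewrite subr_eq0.
  have := hd (y - x) yx0 yd; rewrite (addrC x) subrK => /(_ yb).
  rewrite normrM normfV ler_pdivrMr ?normr_gt0 // mul1r distrC => h.
  exact: le_trans h (ltW ye).
have cg : {within `[0, b], continuous g}%classic.
  apply/continuous_within_itvP => //; split.
  - move=> x; rewrite in_itv /= => /andP[x0 xb].
    apply/cvgrPdist_le => e e0.
    have [|d d0 hd] := gc x _ e e0; first by rewrite !ltW.
    apply/nbhs_ballP; exists (Num.min d (Num.min x (b - x))) => /=.
      by rewrite !lt_min d0 x0 subr_gt0.
    move=> y; rewrite /ball /= distrC !lt_min => /and3P[y1 y2 y3].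
    apply: hd => //; move: y2 y3; rewrite !ltr_norml; lra.
  - apply/cvgrPdist_le => e e0.
    have [|d d0 hd] := gc 0 _ e e0; first by rewrite lexx ltW.
    apply/nbhs_ballP; exists (Num.min d b) => /=; first by rewrite lt_min d0.
    move=> y; rewrite /ball /= distrC lt_min => /andP[y1 y2] y0.
    apply: hd => //; move: y2; rewrite ltr_norml; lra.
  - apply/cvgrPdist_le => e e0.
    have [|d d0 hd] := gc b _ e e0; first by rewrite lexx ltW.
    apply/nbhs_ballP; exists (Num.min d b) => /=; first by rewrite lt_min d0.
    move=> y; rewrite /ball /= distrC lt_min => /andP[y1 y2] y0.
    apply: hd => //; move: y2; rewrite ltr_norml; lra.
have dg x : x \in `]0, b[%R -> is_derive x 1 g 0.
  rewrite in_itv /= => /andP[x0 xb]; apply/is_derive_eps => e e0.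
  have [|d d0 hd] := hg x _ e e0; first by rewrite !ltW.
  exists (Num.min d (Num.min x (b - x))); first by rewrite !lt_min d0 x0 subr_gt0.
  move=> h h0; rewrite !lt_min => /and3P[h1 h2 h3]; rewrite subr0; apply: hd => //.
  by move: h2 h3; rewrite !ltr_norml; lra.
have [c _ ] := MVT b0 dg cg.
by rewrite mul0r => /eqP; rewrite subr_eq0 => /eqP.
Qed.

Lemma deriv_on0_cst (L : R) f : deriv_on 0 L f (fun=> 0) ->
  forall x, 0 <= x <= L -> f x = f 0.
Proof.
move=> /deriv_onP hf x /andP[x0 xL].
move: x0; rewrite le_eqVlt => /predU1P[<- //|x0].
have key y : 0 <= y <= x -> forall e, 0 < e -> exists2 d, 0 < d &
    forall h, h != 0 -> `|h| < d -> 0 <= y + h <= x ->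
    cnorm ((f (y + h) - f y) / cR h) <= e.
  move=> /andP[y0 yx] e e0.
  have [|d d0 hd] := hf y _ e e0; first by rewrite y0 (le_trans yx).
  exists d => // h h0 hh /andP[h1 h2].
  by have := hd h h0 hh; rewrite subr0; apply; rewrite h1 (le_trans h2).
apply/eqP; rewrite eq_complex; apply/andP; split; apply/eqP.
  apply: (@is_derive0_cst_on (fun t => complex.Re (f t))) => // y yx e e0.
  have [d d0 hd] := key y yx e e0; exists d => // h h0 hh hx.
  have := hd h h0 hh hx; apply: le_trans; apply: le_trans (cnorm_Re _).
  by rewrite -cRV ReM /= mulr0 subr0 ReB.
apply: (@is_derive0_cst_on (fun t => complex.Im (f t))) => // y yx e e0.
have [d d0 hd] := key y yx e e0; exists d => // h h0 hh hx.
have := hd h h0 hh hx; apply: le_trans; apply: le_trans (cnorm_Im _).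
by rewrite -cRV ImM /= mulr0 add0r ImB.
Qed.

Lemma deriv_on_cos a b (mu : C) : deriv_on a b (fsol false mu) (fun x => - mu * fsol true mu x).
Proof. by apply: cder_deriv_on => x; exact: cder_cos. Qed.

Lemma deriv_on_sin a b (mu : C) : deriv_on a b (fsol true mu) (fsol false mu).
Proof. by apply: cder_deriv_on => x; exact: cder_sin. Qed.

Lemma fsol_pythagoras (mu : C) x : 0 <= x ->
  fsol false mu x ^+ 2 + mu * fsol true mu x ^+ 2 = 1.
Proof.
move=> x0.
have h1 := @deriv_on_cos 0 x mu; have h2 := @deriv_on_sin 0 x mu.
have hd : deriv_on 0 x (fun x => fsol false mu x * fsol false mu x
    + mu * (fsol true mu x * fsol true mu x)) (fun=> 0).
  apply: deriv_on_ext (deriv_onD (deriv_onM h1 h1) (deriv_onZ (c := mu) (deriv_onM h2 h2))) => //.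
  by move=> y _; ring.
have xx : 0 <= x <= x by rewrite x0 lexx.
by have := deriv_on0_cst hd xx; rewrite !fsol_at0 mul1r !mulr0 addr0 !expr2.
Qed.

(** The combinations [f c - f1 s] and [f1 c + mu f s], which are Wronskians with the fundamental
    solutions, have zero derivative. Their values at 0 are the initial data, and the identity
    [c^2 + mu s^2 = 1] inverts the resulting system. *)
Lemma ode_unique (L : R) (mu : C) f f1 f2 :
  deriv_on 0 L f f1 -> deriv_on 0 L f1 f2 ->
  (forall x, 0 <= x <= L -> - f2 x = mu * f x) ->
  forall x, 0 <= x <= L ->
    f x = f 0 * fsol false mu x + f1 0 * fsol true mu x /\
    f1 x = f1 0 * fsol false mu x - mu * f 0 * fsol true mu x.
Proof.
move=> hf hf1 hode x xL.
have c := @deriv_on_cos 0 L mu; have s := @deriv_on_sin 0 L mu.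
have ode y : 0 <= y <= L -> f2 y = - (mu * f y).
  by move=> /hode <-; rewrite opprK.
have hA : f x * fsol false mu x + (-1) * (f1 x * fsol true mu x) = f 0.
  have hd : deriv_on 0 L (fun x => f x * fsol false mu x
      + (-1) * (f1 x * fsol true mu x)) (fun=> 0).
    apply: deriv_on_ext (deriv_onD (deriv_onM hf c)
      (deriv_onZ (c := -1) (deriv_onM hf1 s))) => // y /ode ->; by ring.
  by rewrite (deriv_on0_cst hd xL) !fsol_at0; ring.
have hB : f1 x * fsol false mu x + mu * (f x * fsol true mu x) = f1 0.
  have hd : deriv_on 0 L (fun x => f1 x * fsol false mu x
      + mu * (f x * fsol true mu x)) (fun=> 0).
    apply: deriv_on_ext (deriv_onD (deriv_onM hf1 c)
      (deriv_onZ (c := mu) (deriv_onM hf s))) => // y /ode ->; by ring.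
  by rewrite (deriv_on0_cst hd xL) !fsol_at0; ring.
have /andP[x0 _] := xL; have w := fsol_pythagoras mu x0.
rewrite -hA -hB; split.
  by rewrite [LHS](_ : _ = f x * (fsol false mu x ^+ 2 + mu * fsol true mu x ^+ 2));
    [ring|rewrite w mulr1].
by rewrite [LHS](_ : _ = f1 x * (fsol false mu x ^+ 2 + mu * fsol true mu x ^+ 2));
  [ring|rewrite w mulr1].
Qed.

Lemma ode_exists (L : R) (mu u v : C) :
  let f x := u * fsol false mu x + v * fsol true mu x in
  let f1 x := v * fsol false mu x - mu * u * fsol true mu x in
  deriv_on 0 L f f1 /\ deriv_on 0 L f1 (fun x => - (mu * f x)).
Proof.
move=> f f1.
have c := @deriv_on_cos 0 L mu; have s := @deriv_on_sin 0 L mu.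
split.
  apply: deriv_on_ext (deriv_onD (deriv_onZ (c := u) c) (deriv_onZ (c := v) s)) => // x _.
  by rewrite /f1; ring.
apply: deriv_on_ext (deriv_onD (deriv_onZ (c := v) c) (deriv_onZ (c := (- (mu * u))) s)) => x _.
  by rewrite /f1; ring.
by rewrite /f; ring.
Qed.

(** The series are identified with the trigonometric functions through uniqueness for the
    differential equation: [cos (k x)] solves it, and its derivative determines the second
    function. *)
Lemma fsol_real (k x : R) : 0 < k -> 0 <= x ->
  fsol false (cR (k ^+ 2)) x = cR (cos (k * x)) /\
  fsol true (cR (k ^+ 2)) x = cR (sin (k * x) / k).
Proof.
move=> k0 x0.
have ck0 : cR k != 0 by rewrite cR_eq0 gt_eqF.
have dk (y : R) : is_derive y 1 (fun t : R => k * t) k.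
  have := is_deriveZ k (is_derive_id y 1); rewrite /GRing.scale /= mulr1.
  by [].
have dc y : cder (fun t => cR (cos (k * t))) y (cR (- k * sin (k * y))).
  split => /=; last exact: is_derive_cst.
  have := @is_derive1_comp R cos (fun t => k * t) y _ _ (is_derive_cos (k * y)) (dk y).
  by rewrite mulrC mulrN mulNr.
have ds y : cder (fun t => cR (- k * sin (k * t))) y (cR (- (k ^+ 2) * cos (k * y))).
  split => /=; last exact: is_derive_cst.
  have := @is_derive1_comp R sin (fun t => k * t) y _ _ (is_derive_sin (k * y)) (dk y).
  move=> hs; apply: (is_derive_eq (is_deriveZ (- k) hs)).
  by rewrite /GRing.scale /=; ring.
have xx : 0 <= x <= x by rewrite x0 lexx.
have := ode_unique (mu := cR (k ^+ 2)) (cder_deriv_on (a := 0) (b := x) dc) (cder_deriv_on (a := 0) (b := x) ds).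
move=> /(_ _ x xx)[].
  by move=> y _; rewrite -cRN -cRM; congr cR; ring.
rewrite !mulr0 cos0 sin0 mulr0 cR0 cR1 !mul0r !mul1r addr0 mulr1 add0r => h1 h2.
split=> //.
have : cR k * (cR k * fsol true (cR (k ^+ 2)) x) = cR k * cR (sin (k * x)).
  by rewrite -cRM mulrA -expr2 -cRX -[LHS]opprK -h2 -cRN; congr cR; ring.
move=> /(mulfI ck0) => h3.
by apply: (mulfI ck0); rewrite h3 -cRM mulrCA divff ?mulr1 // gt_eqF.
Qed.

End DerivOn.

(** * Residue of the inverse of a matrix family *)

Section LinearAlgebra.
Variable R : realType.
Local Notation C := R[i].

Definition adjmx m n (A : 'M[C]_(m, n)) : 'M[C]_(n, m) := (map_mx conjc A)^T.

Lemma adjmxE m n (A : 'M[C]_(m, n)) i j : adjmx A i j = conjc (A j i).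
Proof. by rewrite !mxE. Qed.

Lemma adjmxM m n p (A : 'M[C]_(m, n)) (B : 'M[C]_(n, p)) :
  adjmx (A *m B) = adjmx B *m adjmx A.
Proof. by rewrite /adjmx map_mxM trmx_mul. Qed.

Lemma mxrank_adj m n (A : 'M[C]_(m, n)) : \rank (adjmx A) = \rank A.
Proof. by rewrite /adjmx mxrank_tr mxrank_map. Qed.

Lemma mxrank_le_ker (F : fieldType) m n p (A : 'M[F]_(m, n)) (B : 'M[F]_(m, p)) :
  (forall a : 'rV_m, a *m A = 0 -> a *m B = 0) -> (\rank B <= \rank A)%N.
Proof.
move=> h; have : (kermx A <= kermx B)%MS.
  apply/rV_subP => v /sub_kermxP /h hv; exact/sub_kermxP.
move/mxrankS; rewrite !mxrank_ker.
have := rank_leq_row A; have := rank_leq_row B; lia.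
Qed.

Variables (n m : nat) (D0 D1 J : 'M[C]_n) (Sel : 'M[C]_(m, n)) (T : 'M[C]_(n, m)).
(** [J] carries left null vectors to right ones, up to conjugation. For the graph, [H1] is Green's
    identity, [H2] the definiteness of the squared norm, and [H3] records that the dual vector
    contains the vertex values with a minus sign. *)
Hypothesis H1 : forall w : 'rV_n, w *m D0 = 0 -> D0 *m adjmx (w *m J) = 0.
Hypothesis H2 : forall w : 'rV_n, w *m D0 = 0 ->
  w *m D1 *m adjmx (w *m J) = 0 -> w = 0.
Hypothesis H3 : forall w : 'rV_n, w *m D0 = 0 ->
  Sel *m adjmx (w *m J) = - adjmx (w *m T).

(** Acting on row vectors from the right, this projects onto the left kernel, because
    [D *m pinvmx D *m D = D]. *)
Definition kerproj (D : 'M[C]_n) : 'M[C]_n := 1%:M - D *m pinvmx D.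
Local Notation P := (kerproj D0).

Lemma kerproj_mul D : kerproj D *m D = 0.
Proof. by rewrite mulmxBl mul1mx mulmxKpV // subrr. Qed.

Lemma kerproj_id k (D : 'M[C]_n) (w : 'M[C]_(k, n)) : w *m D = 0 -> w *m kerproj D = w.
Proof. by move=> h; rewrite mulmxBr mulmx1 mulmxA h mul0mx subr0. Qed.

Local Notation E0 := (D0 + P *m D1).

(** Pairing a null vector [v] with the dual vector of [v P] removes the [D0] term, so [H2] gives
    [v P = 0]. Then [v D0 = 0], which means that [v] equals its own projection [v P]. *)
Lemma regularized_unit : E0 \in unitmx.
Proof.
rewrite -row_free_unit; apply: inj_row_free => v; rewrite mulmxDr mulmxA => hv.
have k0 : v *m P *m D0 = 0 by rewrite -mulmxA kerproj_mul mulmx0.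
have vP0 : v *m P = 0.
  apply: H2 => //; move: (congr1 (mulmx^~ (adjmx (v *m P *m J))) hv).
  by rewrite mulmxDl -(mulmxA v D0) H1 // mulmx0 add0r mul0mx.
by rewrite vP0 mul0mx addr0 in hv; rewrite -(kerproj_id hv).
Qed.

(** The residue of the inverse family: the value at [z = 0] of [E^-1 (z (1 - P) + P)]. *)
Definition resmx : 'M[C]_n := invmx E0 *m P.

Lemma resmx_ker k (a : 'M[C]_(k, n)) : a *m resmx *m D0 = 0.
Proof. by rewrite -!mulmxA kerproj_mul !mulmx0. Qed.

(** Expand [a Sel] as [a Sel E0^-1 (D0 + P D1)] and pair with the dual of [w]; the [D0] term drops
    out. Thus the kernel vector [a Sel resmx] represents, up to sign, the evaluation functional of
    [a] in the energy form, as in the Riesz theorem. *)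
Lemma resmx_pairing (a : 'rV_m) (w : 'rV_n) : w *m D0 = 0 ->
  a *m Sel *m resmx *m D1 *m adjmx (w *m J) = - (a *m adjmx (w *m T)).
Proof.
move=> hw; rewrite -mulmxN -H3 // (mulmxA a Sel (adjmx _)).
set b := a *m Sel.
have hb : b *m invmx E0 *m D0 + b *m resmx *m D1 = b.
  rewrite /resmx (mulmxA b) -(mulmxA _ P) -mulmxDr mulmxKV //.
  exact: regularized_unit.
by rewrite -[in RHS]hb mulmxDl -(mulmxA _ D0) H1 // mulmx0 add0r.
Qed.

Lemma mul_adjmx_ker k (a : 'rV_m) (K : 'M[C]_(k, n)) :
  (forall i, a *m adjmx (row i K *m T) = 0) -> a *m adjmx (K *m T) = 0.
Proof.
move=> h; apply/rowP => i; move: (h i) => /rowP /(_ 0); rewrite !mxE => hi.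
rewrite -[RHS]hi; apply: eq_bigr => j _; rewrite !mxE; congr (_ * conjc _).
by apply: eq_bigr => l _; rewrite !mxE.
Qed.

(** A vector [a Sel resmx] killed by [T] has zero pairing with itself, so [T] loses no rank. By the
    same representation, [a Sel resmx = 0] exactly when [a] annihilates the conjugate evaluations of
    all of [ker D0]; equal left kernels give equal ranks. *)
Lemma rank_residue : \rank (Sel *m resmx *m T) = \rank (kermx D0 *m T).
Proof.
have e1 : \rank (Sel *m resmx *m T) = \rank (Sel *m resmx).
  apply/eqP; rewrite eqn_leq mxrankM_maxl /=; apply: mxrank_le_ker => a ha.
  rewrite mulmxA; apply: H2; first exact: resmx_ker.
  rewrite resmx_pairing ?resmx_ker //.
  by rewrite mulmxA mulmxA in ha; rewrite ha /adjmx map_mx0 trmx0 mulmx0 oppr0.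
rewrite e1 -(mxrank_adj (kermx D0 *m T)); apply/eqP; rewrite eqn_leq.
apply/andP; split; apply: mxrank_le_ker => a ha.
  rewrite mulmxA; apply: H2; first exact: resmx_ker.
  rewrite resmx_pairing ?resmx_ker //.
  have /submxP[y ->] : (a *m Sel *m resmx <= kermx D0)%MS.
    by apply/sub_kermxP; exact: resmx_ker.
  by rewrite -[y *m _ *m T]mulmxA adjmxM mulmxA ha mul0mx oppr0.
apply: mul_adjmx_ker => i.
have hi : row i (kermx D0) *m D0 = 0 by apply/sub_kermxP; exact: row_sub.
apply/eqP; rewrite -oppr_eq0 -resmx_pairing //; rewrite mulmxA in ha.
by rewrite ha !mul0mx.
Qed.

Lemma resolvent_pole (Dq : C -> 'M[C]_n) : mx_uapprox Dq -> Dq 0 = D1 ->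
  exists (rho : R) (H : C -> 'M[C]_n), [/\ 0 < rho, mx_uapprox H, H 0 = resmx &
    forall z, z != 0 -> cnorm z <= rho ->
      D0 + z *: Dq z \in unitmx /\ z *: invmx (D0 + z *: Dq z) = H z].
Proof.
move=> uDq Dq0.
pose E z := (1%:M - P) *m (D0 + z *: Dq z) + P *m Dq z.
have uE : mx_uapprox E.
  apply: mx_uapproxD; apply: mx_uapproxM => //; try exact: mx_uapprox_cst.
  apply: mx_uapproxD; first exact: mx_uapprox_cst.
  by apply: mx_uapproxZ => //; exact: uapprox_id.
have E00 : E 0 = E0.
  by rewrite /E scale0r addr0 Dq0 mulmxBl mul1mx kerproj_mul subr0.
have uE0 : E 0 \in unitmx by rewrite E00 regularized_unit.
have [rho r0 hr] := mx_uapprox_inv uE uE0.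
exists rho, (fun z => invmx (E z) *m (z *: (1%:M - P) + P)); split=> //.
- apply: mx_uapproxM; first exact: mx_uapproxV.
  apply: mx_uapproxD; last exact: mx_uapprox_cst.
  apply: mx_uapproxZ; [exact: uapprox_id|exact: mx_uapprox_cst].
- by rewrite E00 scale0r add0r.
move=> z z0 hz; set D := D0 + z *: Dq z; set H := invmx _ *m _.
(* Since [P] kills [D0], the component [P D] already carries a factor [z]. Multiplying only the
   complementary component by [z] therefore produces exactly [z E(z)]. *)
have PD : P *m D = z *: (P *m Dq z).
  by rewrite mulmxDr kerproj_mul add0r -scalemxAr.
have HD : H *m D = z%:M.
  rewrite -mulmxA mulmxDl PD -scalemxAl -scalerDr -scalemxAr mulVmx ?hr //.
  by rewrite scalemx1.
have HD1 : z^-1 *: H *m D = 1%:M.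
  by rewrite -scalemxAl HD scale_scalar_mx mulVf.
have [_ uD] := mulmx1_unit HD1; split => //.
by rewrite -[H](mulmxK uD) HD mul_scalar_mx.
Qed.

End LinearAlgebra.

(** * Balance in signed graphs *)

Section SignedGraph.
Variables (V E : finType) (o t : E -> V) (F : {set E}) (par : E -> bool).

Lemma connect_inv (T : finType) (r : rel T) (P : T -> Prop) a b :
  (forall x y, r x y -> P x -> P y) -> connect r a b -> P a -> P b.
Proof.
move=> h /connectP[p pa ->]; elim: p a pa => //= c p IH a /andP[rac pc] Pa.
by apply: IH => //; exact: h rac Pa.
Qed.

Lemma connects_sym e a b : connects o t e a b = connects o t e b a.
Proof. by rewrite /connects orbC. Qed.

Lemma adj_sym : symmetric (adj o t F).
Proof.
by move=> a b; apply/existsP/existsP => -[e]; rewrite connects_sym => h; exists e.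
Qed.

Lemma adj_connectC : connect_sym (adj o t F).
Proof. exact: sym_connect_sym adj_sym. Qed.

(* The signed double cover: an edge of parity 1 switches sheets. *)
Definition dcov : rel (V * bool) := fun a b =>
  [exists e in F, connects o t e a.1 b.1 && (b.2 == a.2 (+) par e)].

Lemma dcov_sym : symmetric dcov.
Proof.
suff h a b : dcov a b -> dcov b a by move=> a b; apply/idP/idP; exact: h.
move=> /existsP[e /and3P[eF c /eqP h]]; apply/existsP; exists e.
by rewrite eF connects_sym c h -addbA addbb addbF eqxx.
Qed.

Lemma dcov_connectC : connect_sym dcov.
Proof. exact: sym_connect_sym dcov_sym. Qed.

Lemma dcov_flip a x b y : connect dcov (a, x) (b, y) ->
  connect dcov (a, ~~ x) (b, ~~ y).
Proof.
move=> h.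
have := @connect_inv _ dcov (fun p => connect dcov (a, ~~ x) (p.1, ~~ p.2)) _ _ _ h.
apply=> //.
move=> [c u] [d v] /existsP[e /and3P[eF cc /eqP /= hv]] /= hc.
apply: connect_trans hc (connect1 _); apply/existsP; exists e.
by rewrite eF cc /= hv addNb.
Qed.

Lemma dcov_adj a b : connect dcov a b -> connect (adj o t F) a.1 b.1.
Proof.
move=> h; apply: (@connect_inv _ dcov (fun p => connect (adj o t F) a.1 p.1) _ _ _ h) => //.
move=> c d /existsP[e /and3P[eF cc _]] hc.
by apply: connect_trans hc (connect1 _); apply/existsP; exists e; rewrite eF.
Qed.

Lemma adj_dcov a b x : connect (adj o t F) a b -> exists y, connect dcov (a, x) (b, y).
Proof.
move=> h; apply: (@connect_inv _ (adj o t F) (fun b => exists y, connect dcov (a, x) (b, y)) _ _ _ h).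
  move=> c d /existsP[e /andP[eF cc]] [y hy]; exists (y (+) par e).
  apply: connect_trans hy (connect1 _); apply/existsP; exists e.
  by rewrite eF cc eqxx.
by exists x; exact: connect0.
Qed.

(** The two lifts of [x] are joined in the double cover: some closed walk through [x] has odd total
    parity. *)
Definition unbalanced x := connect dcov (x, false) (x, true).

Lemma unbalanced_any x b : connect dcov (x, b) (x, ~~ b) = unbalanced x.
Proof.
case: b => //; apply/idP/idP => h; first by have := dcov_flip h.
by have := dcov_flip h.
Qed.

Lemma unbalanced_connect x y : connect (adj o t F) x y -> unbalanced x -> unbalanced y.
Proof.
move=> /(adj_dcov false)[b hb]; rewrite -(unbalanced_any x false) -(unbalanced_any y b) => h.
have hb' := hb; rewrite dcov_connectC in hb'.
exact: connect_trans hb' (connect_trans h (dcov_flip hb)).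
Qed.

Lemma ordS_val k (i : 'I_k) : val (ordS i) = if i.+1 == k then 0%N else i.+1.
Proof.
rewrite /=; case: eqP => [->|/eqP h]; first by rewrite modnn.
by rewrite modn_small //; have := ltn_ord i; lia.
Qed.

(* Distinct vertices already force distinct edges: a repeated edge would give
   [k = 2] and even parity. *)
Lemma odd_walk_cycle k (s : nat -> V * bool) : (0 < k)%N ->
  (forall i, (i < k)%N -> dcov (s i) (s i.+1)) ->
  (forall i j, (i < j < k)%N -> (s i).1 <> (s j).1) ->
  (s k).1 = (s 0%N).1 -> (s k).2 = ~~ (s 0%N).2 ->
  exists (es : 'I_k -> E) (ws : 'I_k -> V),
    [/\ is_cycle o t F es ws, odd (\sum_i par (es i)) & forall i, ws i = (s i).1].
Proof.
move=> k0 hs inj hk1 hk2; pose ws (i : 'I_k) := (s i).1.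
have wsS i : ws (ordS i) = (s i.+1).1.
  by rewrite /ws ordS_val; case: eqP => // ->; rewrite hk1.
have /fin_all_exists[es hes] (i : 'I_k) : exists e, [/\ e \in F,
    connects o t e (ws i) (ws (ordS i)) & (s i.+1).2 = (s i).2 (+) par e].
  have /existsP[e /and3P[eF c /eqP h]] := hs i (ltn_ord i).
  by exists e; rewrite wsS.
have winj : injective ws.
  move=> i j hij; apply: val_inj => /=.
  have := ltn_ord i; have := ltn_ord j.
  case: (ltngtP (i : nat) j) => // h jk ik; exfalso.
    by apply: (inj i j); rewrite ?h.
  by apply: (inj j i); rewrite ?h.
have odd_par : odd (\sum_i par (es i)).
  have -> : (\sum_i par (es i) = \sum_(i < k) ((s i).2 (+) (s i.+1).2))%N.
    by apply: eq_bigr => i _; case: (hes i) => _ _ ->; rewrite addbA addbb addFb.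
  suff -> : odd (\sum_(i < k) ((s i).2 (+) (s i.+1).2)) = (s 0%N).2 (+) (s k).2.
    by rewrite hk2; case: (s 0%N).2.
  move: {hs inj hk1 hk2 ws wsS es hes winj k0} k => k.
  elim: k => [|k IH]; first by rewrite big_ord0 addbb.
  by rewrite big_ord_recr /= oddD IH oddb -addbA (addbA (s k).2) addbb addFb.
exists es, ws; split=> //; split=> //; last first.
- by move=> i; case: (hes i).
- by move=> i; case: (hes i).
move=> i j eij; apply/eqP; apply/negPn/negP => nij.
have [_ ci _] := hes i; have [_ cj _] := hes j.
(* Equal edges run through in the same direction would already identify [ws i] with [ws j], so the
   repeated edge is traversed once each way. *)
have [/winj h1 /winj h2] : ws i = ws (ordS j) /\ ws (ordS i) = ws j.
  move: ci cj; rewrite eij /connects.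
  move=> /orP[]/andP[/eqP a1 /eqP a2] /orP[]/andP[/eqP b1 /eqP b2].
  - by case/eqP: nij; apply: winj; rewrite -a1.
  - by rewrite -a1 -a2.
  - by rewrite -a1 -a2.
  - by case/eqP: nij; apply: winj; rewrite -a2.
have k2 : k = 2%N.
  have nij' : nat_of_ord i <> nat_of_ord j by move=> h; case/eqP: nij; exact: val_inj.
  have := congr1 val h1; have := congr1 val h2; rewrite !ordS_val /=.
  have := ltn_ord i; have := ltn_ord j.
  by case: eqP => h3; case: eqP => h4; lia.
move: es i j eij nij odd_par {ws wsS hes winj ci cj h1 h2 hs inj hk1 hk2 k0}.
rewrite k2 => es i j eij nij.
suff -> : es ord0 = es (lift ord0 ord0) -> odd (\sum_i par (es i)) = false.
  by rewrite //.
  move: eij nij; rewrite -val_eqE.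
  case: i => -[|[|//]] hi; case: j => -[|[|//]] hj //= eij _.
    by rewrite (_ : ord0 = Ordinal hi) ?eij; [congr es|]; apply: val_inj.
  by rewrite (_ : ord0 = Ordinal hj) -?eij; [congr es|]; apply: val_inj.
by move=> e01; rewrite !big_ord_recl big_ord0 e01 addn0 oddD addbb.
Qed.

Lemma last_take_nth (T : Type) (x : T) p i : (i <= size p)%N ->
  last x (take i p) = nth x (x :: p) i.
Proof.
by move=> h; rewrite (last_nth x) size_takel // -[x :: take i p]/(take i.+1 (x :: p)) nth_take.
Qed.

Lemma path_segment (T : Type) (r : rel T) (x : T) p i j : (i <= j <= size p)%N ->
  path r x p -> path r (nth x (x :: p) i) (take (j - i) (drop i p)) /\
    last (nth x (x :: p) i) (take (j - i) (drop i p)) = nth x (x :: p) j.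
Proof.
move=> /andP[ij jp] xp; have ip := leq_trans ij jp.
have E1 : take j p = take i p ++ take (j - i) (drop i p).
  by rewrite -takeD subnKC.
split; last by rewrite -!last_take_nth // E1 last_cat.
have := xp; rewrite -{1}(cat_take_drop j p) cat_path => /andP[+ _].
by rewrite E1 cat_path last_take_nth // => /andP[].
Qed.

(** Take a shortest walk joining the two lifts of any vertex of the component. A vertex repeated on
    the same sheet contradicts simplicity of the path; one repeated on opposite sheets bounds a
    shorter walk of the same kind, based at that vertex. This is why the base point is allowed to
    vary. *)
Lemma unbalanced_cycle x : unbalanced x -> exists k (es : 'I_k -> E) (ws : 'I_k -> V),
  [/\ is_cycle o t F es ws, odd (\sum_i par (es i)) &
      forall i, connect (adj o t F) x (ws i)].
Proof.
move=> ux.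
pose Q n := [exists a : V * bool, [exists p : n.-tuple (V * bool),
  [&& connect (adj o t F) x a.1, path dcov a p & last a p == (a.1, ~~ a.2)]]].
have exQ : exists n, Q n.
  have /connectP[p pp lp] := ux; exists (size p); apply/existsP; exists (x, false).
  by apply/existsP; exists (in_tuple p); rewrite /= connect0 pp -lp eqxx.
have [n /existsP[a /existsP[p0 /and3P[xa pa /eqP la]]] minQ] := ex_minnP exQ.
move: pa la; set p0' := tval p0 => pa; have sz0 : size p0' = n by rewrite size_tuple.
case: (shortenP pa) => p pp up subp lp.
have sz : (size p <= n)%N by rewrite -sz0 uniq_leq_size //; case/andP: up.
have minp a' q : connect (adj o t F) x a'.1 -> path dcov a' q ->
    last a' q = (a'.1, ~~ a'.2) -> (size p <= size q)%N.
  move=> h1 h2 h3; apply: leq_trans sz _; apply: minQ.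
  apply/existsP; exists a'; apply/existsP; exists (in_tuple q).
  by rewrite /= h1 h2 h3 eqxx.
pose s i := nth a (a :: p) i.
have s0 : s 0%N = a by [].
have sk : s (size p) = (a.1, ~~ a.2) by rewrite /s -last_nth lp.
have p_gt0 : (0 < size p)%N.
  by case: (p) lp => //= /(congr1 snd) /=; case: a.2.
have hs i : (i < size p)%N -> dcov (s i) (s i.+1).
  by move=> ip; move/pathP: pp => /(_ a i ip).
have xs i : (i <= size p)%N -> connect (adj o t F) x (s i).1.
  elim: i => [_|i IH ip]; first by rewrite s0.
  apply: connect_trans (IH (ltnW ip)) _.
  by apply: (@dcov_adj (s i) (s i.+1)); exact/connect1/hs.
have inj i j : (i < j < size p)%N -> (s i).1 <> (s j).1.
  move=> /andP[ij jp] eqs.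
  have [e2|ne2] := eqVneq (s i).2 (s j).2.
    have : s i = s j by move: eqs e2; case: (s i) => ? ?; case: (s j) => ? ? /= -> ->.
    move/eqP; rewrite /s nth_uniq //= ?ltnS; [by move=> /eqP h; move: ij; rewrite h ltnn
      |exact: ltnW (ltn_trans ij jp)|exact: ltnW].
  have [h1 h2] : path dcov (s i) (take (j - i) (drop i p)) /\
      last (s i) (take (j - i) (drop i p)) = s j.
    by apply: path_segment => //; rewrite (ltnW ij) (ltnW jp).
  have ip : (i <= size p)%N by exact: ltnW (ltn_trans ij jp).
  have := minp (s i) _ (xs i ip) h1.
  rewrite h2 {1}[s j]surjective_pairing -eqs.
  have -> : (s j).2 = ~~ (s i).2 by move: ne2; case: (s i).2; case: (s j).2.
  move=> /(_ erefl); rewrite size_takel; last by rewrite size_drop leq_sub2r // ltnW.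
  by rewrite leqNgt (leq_ltn_trans (leq_subr _ _) jp).
have [|| es [ws [h1 h2 h3]]] := odd_walk_cycle p_gt0 hs inj.
- by rewrite sk s0.
- by rewrite sk s0.
exists (size p), es, ws; split=> // i; rewrite h3; apply: xs; exact: ltnW.
Qed.

End SignedGraph.

(** The maps [f] and [g] have to be mutually inverse on the two row spaces only, not on the ambient
    spaces. *)
Lemma mxrank_iso (K : fieldType) p q n k (A : 'M[K]_(p, n)) (B : 'M[K]_(q, k))
    (f : 'M[K]_(n, k)) (g : 'M[K]_(k, n)) :
  (A *m f <= B)%MS -> A *m f *m g = A -> (B *m g <= A)%MS -> B *m g *m f = B ->
  \rank A = \rank B.
Proof.
move=> h1 h2 h3 h4; apply/eqP; rewrite eqn_leq; apply/andP; split.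
  by rewrite -h2; apply: leq_trans (mxrankM_maxl _ _) (mxrankS h1).
by rewrite -h4; apply: leq_trans (mxrankM_maxl _ _) (mxrankS h3).
Qed.

(** * Rank of the signed incidence matrix *)

Section SignedIncidence.
Variables (K : numFieldType) (V E : finType) (o t : E -> V) (F : {set E}) (par : E -> bool).
Local Notation sg b := ((-1) ^+ (nat_of_bool b) : K).
Local Notation dcov := (dcov o t F par).
Local Notation unbalanced := (unbalanced o t F par).
Local Notation conn := (connect (adj o t F)).

(** The sign is the factor by which the derivative of a sine changes along an edge of [n] half
    periods. Multiplying a row of edge coefficients by this matrix gives the flux at every vertex; a
    loop contributes both of its terms. *)
Definition signed_incid : 'M[K]_(#|F|, #|V|) := \matrix_(i, j)
  (sg (par (enum_val i)) * (t (enum_val i) == enum_val j)%:R - (o (enum_val i) == enum_val j)%:R).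

Lemma sg_sqr b : sg b * sg b = 1.
Proof. by rewrite -expr2 sqrr_sign. Qed.

(** On a balanced component this is the sign of the sheet reached from [(x, false)]. On an
    unbalanced one both sheets are reached and the indicators cancel; on the other components both
    are zero. *)
Definition potential x v : K :=
  (connect dcov (x, false) (v, false))%:R - (connect dcov (x, false) (v, true))%:R.

Definition edge_compat (y : V -> K) := forall e, e \in F -> y (o e) = sg (par e) * y (t e).

Lemma edge_compat_dcov y a b : edge_compat y -> connect dcov a b ->
  sg b.2 * y b.1 = sg a.2 * y a.1.
Proof.
move=> hy h; apply: (@connect_inv _ dcov (fun p => sg p.2 * y p.1 = sg a.2 * y a.1) _ _ _ h) => //.
move=> c d /existsP[e /and3P[eF cc /eqP hd]] <-.
rewrite hd signr_addb -mulrA; congr (_ * _).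
case/orP: cc => /andP[/eqP h1 /eqP h2]; rewrite -h1 -h2 hy //.
by rewrite mulrA sg_sqr mul1r.
Qed.

Lemma edge_compat_connects y e a b : edge_compat y -> e \in F -> connects o t e a b ->
  y a = sg (par e) * y b.
Proof.
move=> hy eF /orP[]/andP[/eqP h1 /eqP h2]; rewrite -h1 -h2 hy //.
by rewrite mulrA sg_sqr mul1r.
Qed.

Lemma potential_compat x : edge_compat (potential x).
Proof.
move=> e eF.
have h b : connect dcov (x, false) (o e, b) = connect dcov (x, false) (t e, b (+) par e).
  have st : dcov (o e, b) (t e, b (+) par e).
    by apply/existsP; exists e; rewrite eF /connects /= !eqxx.
  apply/idP/idP => hc; apply: connect_trans hc (connect1 _) => //.
  by rewrite dcov_sym.
by rewrite /potential !h; case: (par e) => /=; rewrite ?expr1 ?mulN1r ?opprB ?expr0 ?mul1r.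
Qed.

Lemma potential_bal x v b : ~~ unbalanced x -> connect dcov (x, false) (v, b) ->
  potential x v = sg b.
Proof.
move=> ux h.
have h' : connect dcov (x, false) (v, ~~ b) = false.
  apply/negP => h2; case/negP: ux; apply: connect_trans h2 _.
  by rewrite dcov_connectC; have := dcov_flip h.
rewrite /potential; case: b h h' => /= -> ->; first by rewrite sub0r expr1.
by rewrite subr0 expr0.
Qed.

Lemma potential_out x v : ~~ conn x v -> potential x v = 0.
Proof.
move=> h; have h' b : connect dcov (x, false) (v, b) = false.
  by apply/negP => /dcov_adj /= hc; case/negP: h.
by rewrite /potential !h' subrr.
Qed.

Lemma edge_compat_unbalanced y x : edge_compat y -> unbalanced x -> y x = 0.
Proof.
move=> hy /(edge_compat_dcov hy) /=; rewrite expr1 expr0 mulN1r mul1r => /eqP.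
by rewrite eq_sym -subr_eq0 opprK -mulr2n mulrn_eq0 => /eqP.
Qed.

Definition balanced_comps : {set {set V}} :=
  [set Cm in components o t F | [exists x in Cm, ~~ unbalanced x]].

Lemma compsP (Cm : {set V}) : Cm \in components o t F ->
  exists x, Cm = [set y | conn x y].
Proof. by move=> /imsetP[x _ ->]; exists x. Qed.

Lemma mem_balanced x : ([set y | conn x y] \in balanced_comps) = ~~ unbalanced x.
Proof.
rewrite inE imset_f //=; apply/existsP/idP => [[y]|ux].
  rewrite inE => /andP[xy]; apply: contra; exact: unbalanced_connect.
by exists x; rewrite inE connect0.
Qed.

Lemma comp_eq x z : conn x z -> [set y | conn x y] = [set y | conn z y].
Proof.
move=> h; apply/setP => y; rewrite !inE.
exact: (same_connect (@adj_connectC _ _ o t F)).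
Qed.

Lemma ker_tr_incid (y : 'rV[K]_#|V|) : y *m signed_incid^T = 0 <->
  edge_compat (fun v => y 0 (enum_rank v)).
Proof.
have sum1 (w : V) (c : K) : \sum_(j < #|V|) y 0 j * (c * (w == enum_val j)%:R)
    = c * y 0 (enum_rank w).
  rewrite (bigD1 (enum_rank w)) //= enum_rankK eqxx mulr1 big1 ?addr0 1?mulrC // => j nj.
  suff -> : (w == enum_val j) = false by rewrite !mulr0.
  by apply: contraNF nj => /eqP ->; rewrite enum_valK.
have E1 i : (y *m signed_incid^T) 0 i = sg (par (enum_val i)) * y 0 (enum_rank (t (enum_val i)))
    - y 0 (enum_rank (o (enum_val i))).
  rewrite mxE -[X in _ - X]mul1r -!sum1 -sumrB; apply: eq_bigr => j _.
  by rewrite !mxE mul1r mulrBr.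
split=> [h e eF|h].
  have := congr1 (fun A : 'rV_#|F| => A 0 (enum_rank_in eF e)) h.
  by rewrite E1 mxE enum_rankK_in // => /eqP; rewrite subr_eq0 => /eqP.
apply/rowP => i; rewrite E1 mxE -h ?subrr //.
exact: enum_valP.
Qed.

(** A compatible function vanishes on unbalanced components, and on a balanced one it is the value
    at a representative times the potential. So [f] reads off the values at representatives and [g]
    rebuilds the function from potentials. *)
Lemma rank_ker_tr_incid : \rank (kermx signed_incid^T) = #|balanced_comps|.
Proof.
have /fin_all_exists[rep hrep] (j : 'I_#|balanced_comps|) :
    exists x, enum_val j = [set y | conn x y] :> {set V}.
  by have := enum_valP j; rewrite inE => /andP[/compsP].
have urep j : ~~ unbalanced (rep j).
  by rewrite -mem_balanced -hrep; exact: enum_valP.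
pose f : 'M[K]_(#|V|, #|balanced_comps|) := \matrix_(v, j) (v == enum_rank (rep j))%:R.
pose g : 'M[K]_(#|balanced_comps|, #|V|) := \matrix_(j, v) potential (rep j) (enum_val v).
rewrite -[RHS](mxrank1 K).
apply: (@mxrank_iso _ _ _ _ _ _ _ f g); first exact: submx1.
- apply/row_matrixP => r; rewrite (row_mul r _ g) (row_mul r _ f); set y := row r (kermx _).
  have /ker_tr_incid hy : y *m signed_incid^T = 0.
    by apply/sub_kermxP; rewrite /y; exact: row_sub.
  clearbody y.
  apply/rowP => v0; rewrite mxE -[v0]enum_valK; move: (enum_val v0) => v {v0}.
  have yf j : (y *m f) 0 j = y 0 (enum_rank (rep j)).
    rewrite mxE (bigD1 (enum_rank (rep j))) //= mxE eqxx mulr1 big1 ?addr0 // => w.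
    by rewrite mxE => /negbTE ->; rewrite mulr0.
  under eq_bigr do rewrite yf mxE enum_rankK.
  have [uv|uv] := boolP (unbalanced v).
    rewrite (edge_compat_unbalanced hy uv) big1 // => j _.
    rewrite potential_out ?mulr0 //; apply: contra (urep j) => h.
    by apply: unbalanced_connect uv; rewrite adj_connectC.
  have vB : [set y | conn v y] \in balanced_comps by rewrite mem_balanced.
  pose j := enum_rank_in vB [set y | conn v y].
  have hj : conn (rep j) v.
    have := hrep j; rewrite /j enum_rankK_in // => /setP /(_ v).
    by rewrite !inE connect0.
  rewrite (bigD1 j) //= big1 ?addr0 => [|i ij].
    have [b hb] := adj_dcov par false hj.
    rewrite (potential_bal (urep j) hb); have := edge_compat_dcov hy hb.
    by rewrite /= expr0 mul1r => <-; rewrite mulrAC sg_sqr mul1r.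
  rewrite potential_out ?mulr0 //; apply: contra ij => hi.
  by apply/eqP/enum_val_inj; rewrite !hrep (comp_eq hi) (comp_eq hj).
- rewrite mul1mx; apply/row_subP => j; apply/sub_kermxP/ker_tr_incid => e eF.
  by rewrite !mxE !enum_rankK; exact: potential_compat.
- rewrite mul1mx; apply/matrixP => i j; rewrite !mxE.
  rewrite (bigD1 (enum_rank (rep j))) //= !mxE eqxx mulr1 enum_rankK.
  rewrite big1 ?addr0 => [|w nw]; last by rewrite ?mxE (negbTE nw) mulr0.
  have [->|nij] := eqVneq i j.
    by rewrite (@potential_bal _ _ false) ?urep ?connect0 // expr0.
  rewrite potential_out //; apply: contra nij => hi.
  by apply/eqP/enum_val_inj; rewrite !hrep (comp_eq hi).
Qed.

(** Rank-nullity for the matrix and for its transpose, which share their rank. The additive form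
    avoids truncated subtraction. *)
Lemma rank_ker_incid : (\rank (kermx signed_incid) + #|V| = #|F| + #|balanced_comps|)%N.
Proof.
have := rank_ker_tr_incid; rewrite !mxrank_ker mxrank_tr => <-.
have := rank_leq_row signed_incid; have := rank_leq_col signed_incid; lia.
Qed.

End SignedIncidence.

(** * Odd cycles and unbalanced components *)

Section OddComponents.
Variables (R : realType) (V E : finType) (o t : E -> V) (L : E -> R) (F : {set E})
  (n : E -> nat) (x : R).
Hypotheses (x0 : 0 < x) (hn : forall e, e \in F -> L e = (n e)%:R * x).
Local Notation par := (fun e => odd (n e)).

Lemma odd_lengthE k (es : 'I_k -> E) : (forall i, es i \in F) ->
  odd_length L x es <-> odd (\sum_i par (es i)).
Proof.
move=> hF.
have LE : \sum_i L (es i) = (\sum_i n (es i))%:R * x.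
  by rewrite natr_sum mulr_suml; apply: eq_bigr => i _; exact: hn.
have oE : odd (\sum_i par (es i)) = odd (\sum_i n (es i)).
  by apply: (big_ind2 (fun a b => odd a = odd b)) => // [a b c d h1 h2|i _];
    rewrite ?oddD ?h1 ?h2 ?oddb.
rewrite oE; split=> [[m [om]]|h]; last by exists (\sum_i n (es i))%N.
rewrite LE => /(mulIf (lt0r_neq0 x0)) /eqP; rewrite eqr_nat => /eqP ->.
exact: om.
Qed.

(** On a balanced component the potential never vanishes and changes by the sign of each edge.
    Multiplying these relations around an odd cycle shows that the nonzero product of its values
    equals its own negative. The converse extracts a cycle from a shortest odd closed walk. *)
Lemma odd_comp_unbalanced v :
  (exists k (es : 'I_k -> E) (ws : 'I_k -> V),
     [/\ is_cycle o t F es ws, odd_length L x es &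
         forall i, ws i \in [set y | connect (adj o t F) v y]]) <->
  unbalanced o t F par v.
Proof.
split=> [[k [es [ws [[k0 _ _ eF hc] /odd_lengthE ho hw]]]]|].
  apply/negPn/negP => uv.
  pose p := potential rat o t F par v.
  have pn0 i : p (ws i) != 0.
    have := hw i; rewrite inE => /(adj_dcov par false)[b hb].
    by rewrite /p (potential_bal _ uv hb) signr_eq0.
  have pe i : p (ws i) = (-1) ^+ par (es i) * p (ws (ordS i)).
    exact: (edge_compat_connects (@potential_compat rat _ _ o t F par v)).
  have : \prod_i p (ws i) = (-1) ^+ (\sum_i par (es i))%N * \prod_i p (ws i).
    rewrite [X in _ = _ * X](reindex_inj (@ordS_inj k)) -prodrXr -big_split.
    by apply: eq_bigr => i _ /=; rewrite {1}pe.
  have pr0 : \prod_i p (ws i) != 0 by apply/prodf_neq0 => i _; exact: pn0.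
  rewrite -signr_odd (ho eF) expr1 mulN1r => /eqP.
  by rewrite -subr_eq0 opprK -mulr2n mulrn_eq0 (negbTE pr0).
move=> /unbalanced_cycle[k [es [ws [h1 h2 h3]]]]; exists k, es, ws; split=> //.
  by apply/odd_lengthE => //; case: h1.
by move=> i; rewrite inE.
Qed.

Lemma beta0_oddE : (beta0_odd o t L F x + #|balanced_comps o t F par| = beta0 o t F)%N.
Proof.
rewrite /beta0_odd /beta0 -[RHS](cardsID (balanced_comps o t F par)) addnC; congr (_ + _)%N.
  by apply: eq_card => Cm; rewrite !inE andbA andbb.
apply: eq_card => Cm; rewrite finset.in_setD finset.in_set.
have [/compsP[v ->]|//] := boolP (Cm \in components o t F); last by rewrite !andbF.
rewrite andbT /= mem_balanced negbK; apply/asboolP/idP; first by move/odd_comp_unbalanced.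
by move=> ?; apply/odd_comp_unbalanced.
Qed.

End OddComponents.

(** * The vertex conditions as a linear system *)

Section TrigFacts.
Variable R : realType.
Implicit Types x y : R.

(** Strictness is what makes the edge energy definite. Below 1 the mean value theorem gives
    [sin y = y cos c] with [sin c > 0], which excludes [cos c >= 1]. *)
Lemma sin_lt_id y : 0 < y -> `|sin y| < y.
Proof.
move=> y0; have [y1|y1] := ltP 1 y.
  by apply: le_lt_trans y1; rewrite ler_norml sin_le1 sin_geN1.
have ypi : y < pi by have := @pi_ge2 R; lra.
have sy : 0 < sin y by apply: sin_gt0_pi; rewrite y0.
rewrite gtr0_norm //.
have cs : {within `[0, y], continuous (@sin R)}%classic.
  by apply: continuous_subspaceT; exact: continuous_sin.
have [c] := MVT y0 (fun x _ => is_derive_sin x) cs.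
rewrite in_itv /= sin0 !subr0 => /andP[c0 cy] ->.
rewrite gtr_pMl // ltNge; apply/negP => c1.
have sc : 0 < sin c by apply: sin_gt0_pi; rewrite c0 (lt_trans cy).
by have := cos2Dsin2 c; nra.
Qed.

Lemma cos_natpi n : cos (n%:R * pi) = (-1) ^+ n :> R.
Proof.
elim: n => [|n IH]; first by rewrite mul0r cos0.
by rewrite -natr1 mulrDl mul1r cosDpi IH exprS mulN1r.
Qed.

Lemma sin_natpi n : sin (n%:R * pi) = 0 :> R.
Proof.
elim: n => [|n IH]; first by rewrite mul0r sin0.
by rewrite -natr1 mulrDl mul1r sinDpi IH oppr0.
Qed.

Lemma sin_eq0 y : 0 <= y -> sin y = 0 -> exists n : nat, y = n%:R * pi.
Proof.
move=> y0 sy; have p0 := @pi_gt0 R.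
have q0 : 0 <= y / pi by rewrite divr_ge0 // ltW.
have /andP[n1 n2] := truncn_itv q0; set n := Num.truncn _ in n1 n2.
exists n; rewrite ler_pdivlMr // in n1; rewrite ltr_pdivrMr // -natr1 mulrDl mul1r in n2.
have : sin (y - n%:R * pi) = 0.
  by rewrite sinB sy sin_natpi mul0r mulr0 subr0.
move: n1; rewrite le_eqVlt => /predU1P[-> //|n1].
by move/eqP; rewrite gt_eqF // sin_gt0_pi //; lra.
Qed.

End TrigFacts.

Section GraphOperator.
Variables (R : realType) (V E : finType) (o t : E -> V) (L : E -> R).
Local Notation C := R[i].
Local Notation I := ((E + V)%type : finType).
Local Notation rk := (@enum_rank I).

(* A row vector over [E + V] lists the outgoing derivatives [f_e'(0)] and the
   vertex values; the columns list the mismatch at the terminal vertex of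
   each edge and the flux at each vertex. *)
Definition transfer_coef (c s m : E -> C) (i j : I) : C :=
  match i, j with
  | inl e', inl e => if e == e' then s e else 0
  | inr v', inl e => if o e == v' then c e else 0
  | inl e', inr v => if t e' == v then c e' else 0
  | inr v', inr v => \sum_(e | (t e == v) && (o e == v')) m e
  end.

(** Kept apart because it does not depend on [mu]: only [transfer_coef] has to be expanded in
    [z]. *)
Definition source_coef (i j : I) : C :=
  match i, j with
  | inr v', inl e => if t e == v' then 1 else 0
  | inl e', inr v => if o e' == v then 1 else 0
  | _, _ => 0
  end.

(** With [c] the cosines and [m] equal to [- mu] times the sines, this sends the data of a solution
    to its derivatives [f_e'(L e)] and its negated vertex values, the boundary data that Green's
    identity pairs with the columns of [D]. *)
Definition dual_coef (c m : E -> C) (i j : I) : C :=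
  match i, j with
  | inl e', inl e => if e == e' then c e else 0
  | inr v', inl e => if o e == v' then m e else 0
  | inr v', inr v => if v == v' then -1 else 0
  | _, _ => 0
  end.

Definition mx_of (g : I -> I -> C) : 'M[C]_#|I| := \matrix_(i, j) g (enum_val i) (enum_val j).

Definition slope (w : 'rV[C]_#|I|) e : C := w 0 (rk (inl e)).
Definition value (w : 'rV[C]_#|I|) v : C := w 0 (rk (inr v)).

Lemma sum_enum_val (f : I -> C) : \sum_(i < #|I|) f (enum_val i) = \sum_i f i.
Proof. by rewrite [RHS](reindex _ (onW_bij _ (enum_val_bij _))). Qed.

Lemma row_eqP (w w' : 'rV[C]_#|I|) : (forall e, slope w e = slope w' e) ->
  (forall v, value w v = value w' v) -> w = w'.
Proof.
move=> h1 h2; apply/rowP => j; rewrite -[j]enum_valK.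
by case: (enum_val j) => [e|v]; [exact: h1|exact: h2].
Qed.

Lemma mul_mx_of w (g : I -> I -> C) j : (w *m mx_of g) 0 (rk j) =
  \sum_e slope w e * g (inl e) j + \sum_v value w v * g (inr v) j.
Proof.
transitivity (\sum_(i : I) w 0 (rk i) * g i j); last by rewrite big_sumType.
rewrite -(sum_enum_val (fun i => w 0 (rk i) * g i j)) mxE.
by apply: eq_bigr => i _; rewrite mxE enum_valK enum_rankK.
Qed.

Lemma sum_if1 (T : finType) (a : T) (f : T -> C) (c : C) :
  \sum_i f i * (if a == i then c else 0) = c * f a.
Proof.
rewrite (bigD1 a) //= eqxx big1 ?addr0 1?mulrC // => i.
by rewrite eq_sym => /negbTE ->; rewrite mulr0.
Qed.

Lemma sum_ifl (P : pred E) (f g : E -> C) :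
  \sum_e f e * (if P e then g e else 0) = \sum_(e | P e) g e * f e.
Proof.
by rewrite [RHS]big_mkcond; apply: eq_bigr => e _; case: ifP; rewrite ?mulr0 // mulrC.
Qed.

Lemma transfer_inl w c s m e :
  slope (w *m mx_of (transfer_coef c s m)) e = c e * value w (o e) + s e * slope w e.
Proof.
rewrite [LHS]mul_mx_of /= addrC; congr (_ + _); first exact: sum_if1.
exact: sum_if1.
Qed.

Lemma transfer_inr w c s m v :
  value (w *m mx_of (transfer_coef c s m)) v =
  \sum_(e | t e == v) (m e * value w (o e) + c e * slope w e).
Proof.
rewrite [LHS]mul_mx_of /= big_split /= addrC; congr (_ + _); first exact: (sum_ifl (fun e => t e == v)).
under eq_bigr do rewrite mulr_sumr.
rewrite (exchange_big_dep (fun e => t e == v)) /=; last by move=> v' e _ /andP[].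
apply: eq_bigr => e tev; rewrite (big_pred1 (o e)) 1?mulrC // => v' /=.
by rewrite tev eq_sym.
Qed.

Lemma source_inl w e : slope (w *m mx_of source_coef) e = value w (t e).
Proof.
rewrite [LHS]mul_mx_of /= big1 ?add0r => [|e' _]; last by rewrite mulr0.
by rewrite sum_if1 mul1r.
Qed.

Lemma source_inr w v : value (w *m mx_of source_coef) v = \sum_(e | o e == v) slope w e.
Proof.
rewrite [LHS]mul_mx_of /= [X in _ + X]big1 ?addr0 => [|v' _]; last by rewrite mulr0.
by rewrite (sum_ifl (fun e => o e == v)); apply: eq_bigr => e _; rewrite mul1r.
Qed.

Lemma dual_inl w c m e : slope (w *m mx_of (dual_coef c m)) e =
  c e * slope w e + m e * value w (o e).
Proof. by rewrite [LHS]mul_mx_of /=; congr (_ + _); exact: sum_if1. Qed.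

Lemma dual_inr w c m v : value (w *m mx_of (dual_coef c m)) v = - value w v.
Proof.
rewrite [LHS]mul_mx_of /= big1 ?add0r => [|e' _]; last by rewrite mulr0.
by rewrite sum_if1 mulN1r.
Qed.

Lemma slopeB w w' e : slope (w - w') e = slope w e - slope w' e.
Proof. by rewrite /slope !mxE. Qed.
Lemma valueB w w' e : value (w - w') e = value w e - value w' e.
Proof. by rewrite /value !mxE. Qed.

Definition cosE mu e : C := fsol false mu (L e).
Definition sinE mu e : C := fsol true mu (L e).
Definition dsinE mu e : C := - mu * sinE mu e.

Definition Dmx mu : 'M[C]_#|I| :=
  mx_of (transfer_coef (cosE mu) (sinE mu) (dsinE mu)) - mx_of source_coef.

Lemma Dmx_slope w mu e : slope (w *m Dmx mu) e =
  cosE mu e * value w (o e) + sinE mu e * slope w e - value w (t e).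
Proof. by rewrite mulmxBr slopeB transfer_inl source_inl. Qed.

Lemma Dmx_value w mu v : value (w *m Dmx mu) v =
  \sum_(e | t e == v) (dsinE mu e * value w (o e) + cosE mu e * slope w e) -
  \sum_(e | o e == v) slope w e.
Proof. by rewrite mulmxBr valueB transfer_inr source_inr. Qed.

Definition rhs (eta : V -> C) : 'rV[C]_#|I| :=
  \row_i (if enum_val i is inr v then eta v else 0).

Lemma rhs_slope eta e : slope (rhs eta) e = 0.
Proof. by rewrite /slope mxE enum_rankK. Qed.
Lemma rhs_value eta v : value (rhs eta) v = eta v.
Proof. by rewrite /value mxE enum_rankK. Qed.

Definition data_row (f1 : E -> R -> C) (F : V -> C) : 'rV[C]_#|I| :=
  \row_i (match enum_val i with inl e => f1 e 0 | inr v => F v end).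

Lemma data_slope f1 F e : slope (data_row f1 F) e = f1 e 0.
Proof. by rewrite /slope mxE enum_rankK. Qed.
Lemma data_value f1 F v : value (data_row f1 F) v = F v.
Proof. by rewrite /value mxE enum_rankK. Qed.

Hypothesis hL : forall e, 0 < L e.

Lemma edge_sol_formula mu f f1 e x : edge_sol L mu f f1 -> 0 <= x <= L e ->
  f e x = f e 0 * fsol false mu x + f1 e 0 * fsol true mu x /\
  f1 e x = f1 e 0 * fsol false mu x - mu * f e 0 * fsol true mu x.
Proof.
move=> /(_ e)[h1 [f2 [h2 h3]]] hx; exact: (ode_unique h1 h2 h3 hx).
Qed.

Lemma sol_data_row mu f f1 F eta : edge_sol L mu f f1 -> vertex_cont o t L f F ->
  (forall v, flux o t L f1 v = eta v) -> data_row f1 F *m Dmx mu = rhs eta.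
Proof.
move=> hs hc hf.
have hLe e : 0 <= L e <= L e by rewrite lexx ltW.
apply: row_eqP => [e|v].
  rewrite Dmx_slope rhs_slope !data_value data_slope.
  have [h1 _] := edge_sol_formula hs (hLe e); have [h2 h3] := hc e.
  by apply/eqP; rewrite subr_eq0 -h3 h1 h2 mulrC [X in _ + X]mulrC.
rewrite Dmx_value rhs_value -hf /flux; congr (_ - _); apply: eq_bigr => e _; last first.
  by rewrite data_slope.
have [_ ->] := edge_sol_formula hs (hLe e); have [-> _] := hc e.
by rewrite data_value data_slope /dsinE /cosE /sinE; ring.
Qed.

Definition sol_of mu (w : 'rV[C]_#|I|) e (x : R) : C :=
  value w (o e) * fsol false mu x + slope w e * fsol true mu x.
Definition dsol_of mu (w : 'rV[C]_#|I|) e (x : R) : C :=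
  slope w e * fsol false mu x - mu * value w (o e) * fsol true mu x.

Lemma sol_ofP mu w eta : w *m Dmx mu = rhs eta ->
  [/\ edge_sol L mu (sol_of mu w) (dsol_of mu w),
      vertex_cont o t L (sol_of mu w) (value w) &
      forall v, flux o t L (dsol_of mu w) v = eta v].
Proof.
move=> h; split.
- move=> e; have [h1 h2] := ode_exists (L e) mu (value w (o e)) (slope w e).
  split; first exact: h1.
  exists (fun x => - (mu * sol_of mu w e x)); split; first exact: h2.
  by move=> x _; rewrite opprK.
- move=> e; split; first by rewrite /sol_of !fsol_at0 mulr1 mulr0 addr0.
  have := congr1 (slope^~ e) h; rewrite /= Dmx_slope rhs_slope => /eqP.
  by rewrite subr_eq0 => /eqP <-; rewrite /sol_of mulrC [X in _ + X]mulrC.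
- move=> v; have := congr1 (value^~ v) h; rewrite /= Dmx_value rhs_value => <-.
  rewrite /flux; congr (_ - _); apply: eq_bigr => e _.
    by rewrite /dsol_of /dsinE /cosE /sinE; ring.
  by rewrite /dsol_of !fsol_at0 mulr1 mulr0 subr0.
Qed.

Variables (m : nat) (vB : 'I_m -> V).
Definition selB : 'M[C]_(m, #|I|) := \matrix_(l, j) (j == rk (inr (vB l)))%:R.

Lemma mul_selB_tr (w : 'rV[C]_#|I|) k : (w *m selB^T) 0 k = value w (vB k).
Proof.
rewrite mxE (bigD1 (rk (inr (vB k)))) //= !mxE eqxx mulr1 big1 ?addr0 // => j nj.
by rewrite !mxE (negbTE nj) mulr0.
Qed.

Lemma row_selB l : row l selB = rhs (fun v => if v == vB l then 1 else 0).
Proof.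
apply: row_eqP => [e|v]; rewrite ?rhs_slope ?rhs_value /slope /value !mxE (inj_eq enum_rank_inj) //.
by rewrite (inj_eq (@inr_inj _ _)); case: eqP.
Qed.

(** The chosen matrix is pinned down because invertibility gives both a solution for each unit flux
    and uniqueness of its data. The transpose appears since solutions are rows here, whereas [M_B]
    has its sources as columns. *)
Lemma TW_matrixE mu : Dmx mu \in unitmx ->
  TW_matrix o t L vB mu = (selB *m invmx (Dmx mu) *m selB^T)^T.
Proof.
move=> uD; pose w l := row l selB *m invmx (Dmx mu).
have wD l : w l *m Dmx mu = rhs (fun v => if v == vB l then 1 else 0).
  by rewrite mulmxKV // row_selB.
have entry k l : (selB *m invmx (Dmx mu) *m selB^T)^T k l = value (w l) (vB k).
  by rewrite -mul_selB_tr /w -!row_mul !mxE; apply: eq_bigr => j _; rewrite !mxE.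
rewrite /TW_matrix; set S := (fun M : 'M[C]_m => _).
have : S (xget 0 S).
  apply: xgetPex; exists (\matrix_(k, l) value (w l) (vB k)) => l.
  exists (sol_of mu (w l)), (dsol_of mu (w l)), (value (w l)).
  by have [h1 h2 h3] := sol_ofP (wD l); split=> // k; rewrite mxE.
move: (xget 0 S) => M hM; apply/matrixP => k l; rewrite entry.
have [f [f1 [F [h1 h2 h3 ->]]]] := hM l.
have := sol_data_row h1 h2 h3; rewrite -wD => /(can_inj (mulmxK uD)) <-.
by rewrite data_value.
Qed.

End GraphOperator.

Section Conjugation.
Variable R : realType.
Implicit Types x y : R[i].
Lemma conjcD x y : conjc (x + y) = conjc x + conjc y. Proof. exact: rmorphD. Qed.
Lemma conjcM x y : conjc (x * y) = conjc x * conjc y. Proof. exact: rmorphM. Qed.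
Lemma conjcN x : conjc (- x) = - conjc x. Proof. exact: rmorphN. Qed.
Lemma conjc_sum (T : Type) (r : seq T) (P : pred T) (F : T -> R[i]) :
  conjc (\sum_(e <- r | P e) F e) = \sum_(e <- r | P e) conjc (F e).
Proof. exact: rmorph_sum. Qed.
Lemma conjc_cR (x : R) : conjc (cR x) = cR x.
Proof. by rewrite /cR /= oppr0. Qed.
Lemma cR_sum (T : finType) (f : T -> R) : cR (\sum_e f e) = \sum_e cR (f e).
Proof.
elim/big_rec2: _ => [|e a b _ <-]; first exact: cR0.
exact: cRD.
Qed.
End Conjugation.

(* Keeps failed unifications from comparing the defining series. *)
Local Opaque fsol qsol.

(** * Expansion at [lam], Green's identity and the energy form *)

Section AtEigenvalue.
Variables (R : realType) (V E : finType) (o t : E -> V) (L : E -> R).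
Local Notation C := R[i].
Local Notation I := ((E + V)%type : finType).
Hypothesis hL : forall e, 0 < L e.
Hypothesis hnoiso : forall v, (0 < deg o t [set: E] v)%N.
Variable lam : R.
Hypothesis hlam : 0 < lam.
Local Notation k := (Num.sqrt lam).
Local Notation cl := (cR lam).
Local Notation D0 := (Dmx o t L cl).
Local Notation c := (cosE L cl).
Local Notation s := (sinE L cl).
Local Notation dm := (dsinE L cl).

Lemma sqrt_lam_gt0 : 0 < k. Proof. by rewrite sqrtr_gt0. Qed.

Lemma cosE_real e : c e = cR (cos (k * L e)).
Proof.
have [h _] := fsol_real sqrt_lam_gt0 (ltW (hL e)).
by rewrite /cosE -h sqr_sqrtr // ltW.
Qed.

Lemma sinE_real e : s e = cR (sin (k * L e) / k).
Proof.
have [_ h] := fsol_real sqrt_lam_gt0 (ltW (hL e)).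
by rewrite /sinE -h sqr_sqrtr // ltW.
Qed.

Lemma conj_cosE e : conjc (c e) = c e. Proof. by rewrite cosE_real conjc_cR. Qed.
Lemma conj_sinE e : conjc (s e) = s e. Proof. by rewrite sinE_real conjc_cR. Qed.
Lemma conj_dsinE e : conjc (dm e) = dm e.
Proof. by rewrite /dsinE conjcM conjcN conj_sinE conjc_cR. Qed.

Lemma conj_cd e (x y : C) : conjc (c e * x + dm e * y) = c e * conjc x + dm e * conjc y.
Proof. by rewrite conjcD (conjcM (c e)) (conjcM (dm e)) conj_cosE conj_dsinE. Qed.
Lemma conj_dc e (x y : C) : conjc (dm e * x + c e * y) = dm e * conjc x + c e * conjc y.
Proof. by rewrite conjcD (conjcM (c e)) (conjcM (dm e)) conj_cosE conj_dsinE. Qed.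
Lemma conj_cs e (x y : C) : conjc (c e * x + s e * y) = c e * conjc x + s e * conjc y.
Proof. by rewrite conjcD (conjcM (c e)) (conjcM (s e)) conj_cosE conj_sinE. Qed.

(** The transfer matrix of an edge, with rows [(c, s)] and [(dm, c)], has determinant one. *)
Lemma pythE e : c e ^+ 2 - dm e * s e = 1.
Proof.
have := fsol_pythagoras cl (ltW (hL e)); rewrite -/(c e) -/(s e) => <-.
by rewrite /dsinE; ring.
Qed.

(** The divided difference of [Dmx] at [lam]. The last entry comes from the product
    [- mu * sinE mu], both of whose factors vary with [z]. *)
Definition Dq (z : C) : 'M[C]_#|I| := mx_of (transfer_coef o t
  (fun e => qsol false cl (L e) z) (fun e => qsol true cl (L e) z)
  (fun e => - (s e + (cl + z) * qsol true cl (L e) z))).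

Lemma Dmx_expand z : cnorm z <= 1 -> Dmx o t L (cl + z) = D0 + z *: Dq z.
Proof.
move=> hz; rewrite /Dmx addrAC; congr (_ - _); apply/matrixP => i j; rewrite !mxE.
have hc e : cosE L (cl + z) e = c e + z * qsol false cl (L e) z by exact: fsol_qsol.
have hs e : sinE L (cl + z) e = s e + z * qsol true cl (L e) z by exact: fsol_qsol.
case: (enum_val i) => [e'|v']; case: (enum_val j) => [e|v] /=.
- by case: (e == e'); [rewrite hs|rewrite mulr0 addr0].
- by case: (t e' == v); [rewrite hc|rewrite mulr0 addr0].
- by case: (o e == v'); [rewrite hc|rewrite mulr0 addr0].
- rewrite mulr_sumr -big_split; apply: eq_bigr => e _ /=.
  by rewrite /dsinE hs; ring.
Qed.

Lemma uapprox_eq (h h' : C -> C) : h =1 h' -> uapprox h -> uapprox h'.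
Proof. by move=> /funext ->. Qed.

Lemma Dq_uapprox : mx_uapprox Dq.
Proof.
move=> i j; apply: (@uapprox_eq (fun z => transfer_coef o t
  (fun e => qsol false cl (L e) z) (fun e => qsol true cl (L e) z)
  (fun e => - (s e + (cl + z) * qsol true cl (L e) z)) (enum_val i) (enum_val j))).
  by move=> z; rewrite mxE.
case: (enum_val i) => [e'|v']; case: (enum_val j) => [e|v] /=.
- by case: (e == e'); [exact: uapprox_qsol|exact: uapprox_cst].
- by case: (t e' == v); [exact: uapprox_qsol|exact: uapprox_cst].
- by case: (o e == v'); [exact: uapprox_qsol|exact: uapprox_cst].
- apply: uapprox_sum => e; apply: uapproxN; apply: uapproxD; first exact: uapprox_cst.
  apply: uapproxM; last exact: uapprox_qsol.
  by apply: uapproxD; [exact: uapprox_cst|exact: uapprox_id].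
Qed.

Lemma kerDE (w : 'rV[C]_#|I|) : w *m D0 = 0 <->
  (forall e, value w (t e) = c e * value w (o e) + s e * slope w e) /\
  (forall v, \sum_(e | t e == v) (dm e * value w (o e) + c e * slope w e) =
             \sum_(e | o e == v) slope w e).
Proof.
split=> [h|[h1 h2]].
  split=> [e|v].
    have := congr1 (fun u => slope u e) h; rewrite Dmx_slope /slope mxE => /eqP.
    by rewrite subr_eq0 => /eqP.
  have := congr1 (fun u => value u v) h; rewrite Dmx_value /value mxE => /eqP.
  by rewrite subr_eq0 => /eqP.
apply: row_eqP => [e|v].
  by rewrite Dmx_slope h1 subrr /slope mxE.
by rewrite Dmx_value h2 subrr /value mxE.
Qed.

Lemma pair_sum (a b : 'rV[C]_#|I|) : (a *m adjmx b) 0 0 =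
  \sum_e slope a e * conjc (slope b e) + \sum_v value a v * conjc (value b v).
Proof.
transitivity (\sum_(i : I) a 0 (enum_rank i) * conjc (b 0 (enum_rank i))).
  rewrite -(sum_enum_val (fun i => a 0 (enum_rank i) * conjc (b 0 (enum_rank i)))).
  by rewrite mxE; apply: eq_bigr => j _; rewrite !mxE enum_valK.
by rewrite big_sumType.
Qed.

Lemma sum_by_vertex (g : E -> V) (X : E -> C) (Y : V -> C) :
  \sum_v (\sum_(e | g e == v) X e) * Y v = \sum_e X e * Y (g e).
Proof.
under eq_bigr do rewrite mulr_suml.
rewrite (exchange_big_dep xpredT) //=; apply: eq_bigr => e _.
by rewrite (big_pred1 (g e)) // => v; rewrite /= eq_sym.
Qed.

Local Notation J := (mx_of (dual_coef o c dm)).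
(** Green's identity tested against arbitrary data [u]. The unit determinant removes the slopes of
    [u], and what multiplies [value u v] after grouping by vertices is the conjugate flux of [w] at
    [v], which is zero. Conjugation is harmless because the coefficients at real [lam] are real. *)
Lemma dual_annihilates (w : 'rV[C]_#|I|) : w *m D0 = 0 -> D0 *m adjmx (w *m J) = 0.
Proof.
move=> /kerDE[w1 w2].
suff h (u : 'rV[C]_#|I|) : u *m D0 *m adjmx (w *m J) = 0.
  apply/row_matrixP => i; rewrite row0 -[D0]mul1mx !row_mul; exact: h.
apply/rowP => j; rewrite ord1 pair_sum [RHS]mxE.
under eq_bigr do rewrite Dmx_slope dual_inl conj_cd.
under [X in _ + X]eq_bigr do rewrite Dmx_value dual_inr conjcN mulrN mulrBl opprB.
rewrite big_split /= sumrN !(sum_by_vertex _ _ (fun v => conjc (value w v))).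
set b := fun e => conjc (slope w e); set F := fun v => conjc (value w v).
have F1 e : F (t e) = c e * F (o e) + s e * b e.
  by rewrite /F w1 conj_cs.
have F2 v : \sum_(e | t e == v) (dm e * F (o e) + c e * b e) = \sum_(e | o e == v) b e.
  have := congr1 conjc (w2 v); rewrite !conjc_sum => <-; apply: eq_bigr => e _.
  by rewrite conj_dc.
transitivity (\sum_e b e * value u (o e) - \sum_e (dm e * F (o e) + c e * b e) * value u (t e)).
  rewrite addrA -big_split /= -sumrB -[RHS]sumrB.
  apply: eq_bigr => e _; rewrite -/(F (t e)) -/(F (o e)) -/(b e) F1.
  apply/eqP; rewrite -subr_eq0; apply/eqP.
  transitivity ((c e ^+ 2 - dm e * s e - 1) * (b e * value u (o e) - slope u e * F (o e))).
    by ring.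
  by rewrite pythE subrr mul0r.
rewrite -!sum_by_vertex -sumrB big1 // => v _.
by rewrite F2 subrr.
Qed.

(** The closed form of the integral over [[0, L e]] of the square of [x cos (k r) + y sin (k r) / k]
    with respect to [r]. *)
Definition edge_energy (e : E) (x y : R) : R :=
  ((L e + cos (k * L e) * (sin (k * L e) / k)) * x ^+ 2 +
   (L e - cos (k * L e) * (sin (k * L e) / k)) / lam * y ^+ 2 +
   2 * (sin (k * L e) / k) ^+ 2 * x * y) / 2.

Lemma edge_energy_ge0 e x y : 0 <= edge_energy e x y /\
  (edge_energy e x y = 0 -> x = 0 /\ y = 0).
Proof.
rewrite /edge_energy; set cc := cos _; set ss := sin _ / k; set l := L e.
have k0 := sqrt_lam_gt0.
have l0 : 0 < l by exact: hL.
have ssl : `|ss| < l.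
  rewrite normrM normfV (gtr0_norm k0) ltr_pdivrMr // mulrC.
  by apply: sin_lt_id; rewrite mulr_gt0.
have py : cc ^+ 2 + lam * ss ^+ 2 = 1.
  rewrite /ss expr_div_n sqr_sqrtr ?ltW // mulrCA divff ?gt_eqF // mulr1.
  exact: cos2Dsin2.
have c1 : `|cc| <= 1 by rewrite ler_norml cos_geN1 cos_le1.
have csl : `|cc * ss| < l.
  rewrite normrM; apply: le_lt_trans ssl; rewrite ler_piMl //.
have A0 : 0 < l + cc * ss by move: csl; rewrite ltr_norml; lra.
have d0 : 0 < (l ^+ 2 - ss ^+ 2) / lam.
  by rewrite divr_gt0 // subr_gt0 -ltr_sqrt ?exprn_gt0 // !sqrtr_sqr (gtr0_norm l0).
(* Completing the square. By [cc^2 + lam ss^2 = 1] the determinant of the form simplifies to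
   [(l^2 - ss^2) / lam], positive because [|ss| < l]. *)
have key : (l + cc * ss) * ((l + cc * ss) * x ^+ 2 + (l - cc * ss) / lam * y ^+ 2
    + 2 * ss ^+ 2 * x * y) =
    ((l + cc * ss) * x + ss ^+ 2 * y) ^+ 2 + (l ^+ 2 - ss ^+ 2) / lam * y ^+ 2.
  have -> : l ^+ 2 - ss ^+ 2 = l ^+ 2 - ss ^+ 2 * (cc ^+ 2 + lam * ss ^+ 2).
    by rewrite py mulr1.
  by field; rewrite gt_eqF.
move: key; set q := _ + 2 * ss ^+ 2 * x * y => key.
have q0 : 0 <= q.
  rewrite -(pmulr_rge0 _ A0) key addr_ge0 ?sqr_ge0 // mulr_ge0 ?sqr_ge0 //; exact: ltW.
split; first by lra.
move=> /eqP; rewrite mulf_eq0 invr_eq0 pnatr_eq0 orbF => /eqP qe.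
move: key; rewrite qe mulr0 => /esym/eqP.
rewrite paddr_eq0 ?sqr_ge0 //; last by rewrite mulr_ge0 ?sqr_ge0 // ltW.
rewrite (mulf_eq0 ((l ^+ 2 - ss ^+ 2) / lam)) (gt_eqF d0) /= !expf_eq0 /= => /andP[/eqP h1 /eqP y0].
split=> //; move: h1; rewrite y0 mulr0 addr0 => /eqP.
by rewrite (mulf_eq0 (l + cc * ss)) (gt_eqF A0) => /eqP.
Qed.

(** Verified edge by edge after inserting the closed forms of the [mu]-derivatives; the defect is a
    multiple of the Pythagorean relation. The form has real coefficients, so it splits over the real
    and imaginary parts. *)
Lemma energy_pairing (w : 'rV[C]_#|I|) : w *m D0 = 0 ->
  (w *m Dq 0 *m adjmx (w *m J)) 0 0 = cR (\sum_e
    (edge_energy e (complex.Re (value w (o e))) (complex.Re (slope w e)) +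
     edge_energy e (complex.Im (value w (o e))) (complex.Im (slope w e)))).
Proof.
move=> /kerDE[w1 w2]; rewrite pair_sum.
under eq_bigr do rewrite transfer_inl dual_inl conj_cd.
under [X in _ + X]eq_bigr do rewrite transfer_inr dual_inr conjcN mulrN.
rewrite sumrN (sum_by_vertex _ _ (fun v => conjc (value w v))) -sumrB.
rewrite cR_sum.
apply: eq_bigr => e _; rewrite w1 conj_cs.
set a := value w (o e); set b := slope w e.
have l0 : 2 * cl != 0 :> C by rewrite mulf_neq0 ?pnatr_eq0 // cR_eq0 gt_eqF.
have sq : qsol true cl (L e) 0 = (cR (L e) * c e - s e) / (2 * cl).
  by apply: (mulfI l0); rewrite qsol0_sin mulrCA divff // mulr1.
rewrite sq qsol0_cos -/(s e) addr0 /dsinE.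
have py : cl * s e ^+ 2 = 1 - c e ^+ 2.
  by rewrite -(pythE e) /dsinE; ring.
have cl0 : cl != 0 :> C by rewrite cR_eq0 gt_eqF.
transitivity (((cR (L e) + c e * s e) * (a * conjc a)
   + (cR (L e) - c e * s e) / cl * (b * conjc b)
   + s e ^+ 2 * (a * conjc b + conjc a * b)) / 2).
  apply: (mulfI l0); apply/eqP; rewrite -subr_eq0; apply/eqP.
  transitivity ((cl * s e ^+ 2 + c e ^+ 2 - 1) * (cl * cR (L e) * (a * conjc a) + cR (L e) * (b * conjc b))).
    by field.
  by rewrite py subrK subrr mul0r.
rewrite cosE_real sinE_real /edge_energy.
set cc := cos _; set ss := sin _ / k; set l := L e.
case: a => a1 a2; case: b => b1 b2 /=.
have conjE (x y x' y' : R) : Complex x y * Complex x' (- y') + Complex x (- y) * Complex x' y'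
   = cR (2 * (x * x' + y * y')).
  by apply/eqP; rewrite eq_complex /=; apply/andP; split; apply/eqP; ring.
have sqE (x y : R) : Complex x y * Complex x (- y) = cR (x ^+ 2 + y ^+ 2).
  by apply/eqP; rewrite eq_complex /=; apply/andP; split; apply/eqP; ring.
rewrite conjE !sqE -(cR_nat R 2) -!cRV -!cRX -!(cRM, cRD, cRB); congr cR.
by ring.
Qed.

Lemma energy_definite (w : 'rV[C]_#|I|) : w *m D0 = 0 ->
  w *m Dq 0 *m adjmx (w *m J) = 0 -> w = 0.
Proof.
move=> hw h; have [w1 _] := (kerDE w).1 hw.
have := energy_pairing hw; rewrite h mxE => /esym/eqP; rewrite cR_eq0 psumr_eq0 => [/allP hz|e _]; last first.
  by apply: addr_ge0; exact: (edge_energy_ge0 _ _ _).1.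
have z e : value w (o e) = 0 /\ slope w e = 0.
  have := hz e (mem_index_enum e); rewrite /= paddr_eq0; try exact: (edge_energy_ge0 _ _ _).1.
  move=> /andP[/eqP h1 /eqP h2].
  have [_ /(_ h1)[a1 b1]] := edge_energy_ge0 e (complex.Re (value w (o e))) (complex.Re (slope w e)).
  have [_ /(_ h2)[a2 b2]] := edge_energy_ge0 e (complex.Im (value w (o e))) (complex.Im (slope w e)).
  by split; apply/eqP; rewrite eq_complex ?a1 ?a2 ?b1 ?b2 /= eqxx.
apply: row_eqP => [e|v]; first by have [_ ->] := z e; rewrite /slope mxE.
(* The energy sees edge data only; a vertex value is recovered from an edge attached to the
   vertex. *)
rewrite [RHS]mxE; have := hnoiso v; rewrite lt0n sum_nat_eq0 negb_forall => /existsP[e].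
rewrite inE /= addn_eq0 negb_and !eqb0 !negbK => /orP[]/eqP <-; first by have [] := z e.
by rewrite w1; have [-> ->] := z e; rewrite !mulr0 addr0.
Qed.

(** The transfer matrix is invertible, so zero Cauchy data at the terminal end force zero data at
    the origin. *)
Lemma transfer_inj (w : 'rV[C]_#|I|) e : w *m D0 = 0 -> value w (t e) = 0 ->
  dm e * value w (o e) + c e * slope w e = 0 -> value w (o e) = 0 /\ slope w e = 0.
Proof.
move=> /kerDE[w1 _]; rewrite w1 => p0 q0; split.
  transitivity (c e * (c e * value w (o e) + s e * slope w e)
     - s e * (dm e * value w (o e) + c e * slope w e)).
    transitivity ((c e ^+ 2 - dm e * s e) * value w (o e)); last by ring.
    by rewrite pythE mul1r.
  by rewrite p0 q0 !mulr0 subrr.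
transitivity (c e * (dm e * value w (o e) + c e * slope w e)
     - dm e * (c e * value w (o e) + s e * slope w e)).
  transitivity ((c e ^+ 2 - dm e * s e) * slope w e); last by ring.
  by rewrite pythE mul1r.
by rewrite p0 q0 !mulr0 subrr.
Qed.

(* The edges on which an eigenfunction vanishing at the boundary is nonzero
   span a subgraph without vertices of degree one, hence lie in the core. *)
Lemma support_in_core (w : 'rV[C]_#|I|) : w *m D0 = 0 ->
  (forall v, boundary_vertex o t v -> value w v = 0) ->
  [set e | (value w (o e) != 0) || (slope w e != 0)] \subset core_edges o t.
Proof.
move=> hw hb; have [w1 w2] := (kerDE w).1 hw; set N := [set e | _].
have offN e : e \notin N -> value w (o e) = 0 /\ slope w e = 0.
  by rewrite inE negb_or !negbK => /andP[/eqP -> /eqP ->].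
rewrite /core_edges; apply: (@finset.bigcup_sup _ _ N _ id) => //; apply/forallP => v; apply/negP => /sum_nat_eq1[e [eN e1 eother]].
have vE : (o e == v) || (t e == v).
  by move: e1; case: (o e == v); case: (t e == v).
(* If every edge at [v] lay in [N], the degree of [v] in the whole graph would also be one. So [v]
   is a boundary vertex, or it touches an edge on which the function is zero. *)
have Fv0 : value w v = 0.
  have [bv|nbv] := boolP (boundary_vertex o t v); first exact: hb.
  have [e' e'N he'] : exists2 e', e' \notin N & (o e' == v) || (t e' == v).
    apply/exists_inP; apply: contraR nbv; rewrite negb_exists_in => /forall_inP h.
    apply/sum_nat_eq1; exists e; split=> // j nj _; have [jN|jN] := boolP (j \in N).
      exact: eother.
    by have := h j jN; rewrite negb_or => /andP[/negbTE -> /negbTE ->].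
  have [z1 z2] := offN e' e'N; case/orP: he' => /eqP <- //.
  by rewrite w1 z1 z2 !mulr0 addr0.
have others j : j != e -> (o j == v) || (t j == v) -> value w (o j) = 0 /\ slope w j = 0.
  move=> nj hj; apply: offN; apply/negP => jN; have := eother j nj jN.
  by case/orP: hj => ->; rewrite ?addn1 ?addn0.
(* The flux at [v] reduces to the derivative of the single edge [e]. Hence [e] has zero Cauchy data
   at [v], contradicting [e \in N]. *)
suff [z1 z2] : value w (o e) = 0 /\ slope w e = 0 by move: eN; rewrite inE z1 z2 eqxx.
have := w2 v; case/orP: vE => hv.
  have tv : t e == v = false by move: e1; rewrite hv; case: (t e == v).
  rewrite big1 => [|j tj]; last first.
    have [||-> ->] := others j; rewrite ?tj ?orbT ?mulr0 ?addr0 //.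
    by apply: contraFneq tv => <-.
  rewrite (bigD1 e) //= big1 ?addr0 => [<-|j /andP[oj nj]].
    by split=> //; rewrite (eqP hv).
  by have [|_ ->] := others j nj; rewrite ?oj.
have ov : o e == v = false by move: e1; rewrite hv; case: (o e == v).
rewrite [RHS]big1 => [|j oj]; last first.
  have [||_ ->] := others j; rewrite ?oj //.
  by apply: contraFneq ov => <-.
rewrite (bigD1 e) //= big1 ?addr0 => [h|j /andP[tj nj]].
  by apply: transfer_inj => //; rewrite (eqP hv).
by have [|-> ->] := others j nj; rewrite ?tj ?orbT ?mulr0 ?addr0.
Qed.

(** A vertex that is not a proper core vertex has an attached edge outside the core. The function is
    zero on that edge, hence at the vertex. *)
Lemma vanishes_at_vertices (w : 'rV[C]_#|I|) : w *m D0 = 0 ->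
  (forall v, boundary_vertex o t v || proper_core_vertex o t v -> value w v = 0) ->
  forall v, value w v = 0.
Proof.
move=> hw hb v; have [w1 _] := (kerDE w).1 hw.
have [pv|] := boolP (proper_core_vertex o t v); first by rewrite hb // pv orbT.
rewrite negb_forall => /existsP[e]; rewrite negb_imply => /andP[ev ne].
have hb' u : boundary_vertex o t u -> value w u = 0 by move=> bu; rewrite hb // bu.
have : e \notin [set e | (value w (o e) != 0) || (slope w e != 0)].
  by apply: contra ne; exact: (fintype.subsetP (support_in_core hw hb')).
rewrite inE negb_or !negbK => /andP[/eqP z1 /eqP z2].
by case/orP: ev => /eqP <- //; rewrite w1 z1 z2 !mulr0 addr0.
Qed.

End AtEigenvalue.

(** * Residue and kernel of the graph Laplacian *)

Section Residue.
Variables (R : realType) (V E : finType) (o t : E -> V) (L : E -> R).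
Local Notation C := R[i].
Local Notation I := ((E + V)%type : finType).
Hypothesis hL : forall e, 0 < L e.
Hypothesis hnoiso : forall v, (0 < deg o t [set: E] v)%N.
Variable lam : R.
Hypothesis hlam : 0 < lam.
Local Notation k := (Num.sqrt lam).
Local Notation cl := (cR lam).
Local Notation D0 := (Dmx o t L cl).
Local Notation D1 := (Dq o t L lam 0).
Local Notation J := (mx_of (dual_coef o (cosE L cl) (dsinE L cl))).
Variables (m : nat) (vB : 'I_m -> V).
Local Notation Sel := (selB R E vB).

Lemma adj_selB_tr : adjmx Sel^T = Sel.
Proof.
by apply/matrixP => l j; rewrite !mxE; exact: conjc_nat.
Qed.

Lemma selB_dual (w : 'rV[C]_#|I|) : w *m D0 = 0 ->
  Sel *m adjmx (w *m J) = - adjmx (w *m Sel^T).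
Proof.
move=> _; rewrite -{1}adj_selB_tr -adjmxM; apply/colP => l.
by rewrite [RHS]mxE !adjmxE -conjcN; congr conjc; rewrite !mul_selB_tr dual_inr.
Qed.

Lemma min_radius (T : finType) (r : T -> R) (r1 : R) : 0 < r1 -> (forall i, 0 < r i) ->
  exists2 r0, 0 < r0 & r0 <= r1 /\ forall i, r0 <= r i.
Proof.
move=> h1 hr; exists (\big[Num.min/r1]_i r i); first exact: lt_bigmin.
by split=> [|i]; [exact: bigmin_le_id|exact: bigmin_le].
Qed.

(** Each entry has its own admissible radius in the mean value property; their minimum, cut down to
    the region where the expansion and the inverse are valid, serves all entries at once. *)
Lemma Res_TWE : Res_TW o t L vB lam = (Sel *m resmx D0 D1 *m Sel^T)^T.
Proof.
have [rho [H [rho0 uH H0 hH]]] := resolvent_pole (dual_annihilates hL hlam)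
  (energy_definite hL hnoiso hlam) (Dq_uapprox o t L lam) erefl.
pose N z := (Sel *m H z *m Sel^T)^T.
have uN (kl : 'I_m * 'I_m) : uapprox (fun z => N z kl.1 kl.2).
  have u := mx_uapproxM (mx_uapproxM (mx_uapprox_cst Sel) uH) (mx_uapprox_cst Sel^T).
  by apply: uapprox_eq (u kl.2 kl.1) => z; rewrite /N [RHS]mxE.
have /fin_all_exists2[rr rr0 hrr] := fun kl => mean_value (uN kl).
have rho1 : 0 < Num.min rho 1 by rewrite lt_min rho0 ltr01.
have [r0 r00 [r01 hr0]] := min_radius rho1 rr0.
move: r01; rewrite le_min => /andP[r0rho r01].
rewrite /Res_TW; set S := (fun A : 'M[C]_m => _).
have key r : 0 < r < r0 -> (Sel *m resmx D0 D1 *m Sel^T)^T =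
    \matrix_(k0, l) ((2 * cR pi * 'i%C)^-1 *
      cint02pi (fun th => TW_matrix o t L vB (cl + cR r * cexpi th) k0 l
                                  * ('i%C * cR r * cexpi th))).
  move=> /andP[r_gt0 rr1]; apply/matrixP => k0 l; rewrite [RHS]mxE.
  have -> : (Sel *m resmx D0 D1 *m Sel^T)^T k0 l = N 0 k0 l by rewrite /N H0.
  have hkl : 0 < r < rr (k0, l) by rewrite r_gt0 (lt_le_trans rr1) ?hr0.
  rewrite -(hrr (k0, l) r hkl) /=; congr (_ * cint02pi _); apply/funext => th.
  set z := cR r * cexpi th.
  have zr : cnorm z = r by rewrite /z cnormM cnorm_cexpi mulr1 cnorm_cR gtr0_norm.
  have z0 : z != 0 by rewrite -cnorm_eq0 zr gt_eqF.
  have z1 : cnorm z <= 1 by rewrite zr (le_trans (ltW rr1)).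
  have zrho : cnorm z <= rho by rewrite zr (le_trans (ltW rr1)).
  have [uD hD] := hH z z0 zrho; rewrite -Dmx_expand // in uD hD.
  (* The factor [z] in [dmu] turns the inverse of [D] into the regular family [H]. *)
  rewrite (TW_matrixE hL vB uD) /N -hD -scalemxAr -scalemxAl linearZ /=.
  have sE (A : 'M[C]_m) : (z *: A) k0 l = z * A k0 l by rewrite mxE.
  by rewrite sE; move: (_^T k0 l) => a; rewrite /z; ring.
have SA : S (Sel *m resmx D0 D1 *m Sel^T)^T by exists r0 => // r hr; exact: key.
have [r1 r10 h1] : S (xget 0 S) by apply: xgetPex; exists (Sel *m resmx D0 D1 *m Sel^T)^T.
(* A radius admissible both for the chosen residue and for the explicit one; comparing the two
   integrals there identifies the matrices. *)
pose r := Num.min r0 r1 / 2.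
have rm : 0 < Num.min r0 r1 by rewrite lt_min r00 r10.
have hr : r < Num.min r0 r1 by rewrite /r; lra.
have r_gt0 : 0 < r by rewrite /r; lra.
move: hr; rewrite lt_min => /andP[ra rb].
by rewrite (h1 r) ?r_gt0 // -key // r_gt0.
Qed.

Lemma rank_Res : \rank (Res_TW o t L vB lam) = \rank (kermx D0 *m Sel^T).
Proof.
rewrite Res_TWE mxrank_tr; apply: (rank_residue (J := J)).
- exact: dual_annihilates.
- exact: energy_definite.
- exact: selB_dual.
Qed.

(** * Eigenfunctions vanishing at the prescribed vertices *)

Section DirichletKernel.
Local Notation Gl := (Elam L lam).
Variable n : E -> nat.
Hypothesis hn : forall e, e \in Gl -> L e = (n e)%:R * (pi / k).
Local Notation par := (fun e => odd (n e)).

Lemma phase_Gl e : e \in Gl -> k * L e = (n e)%:R * pi.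
Proof.
move=> /hn ->; rewrite mulrCA; congr (_ * _); rewrite mulrCA divff ?mulr1 //.
by rewrite gt_eqF // sqrtr_gt0.
Qed.

Lemma cosE_Gl e : e \in Gl -> cosE L cl e = (-1) ^+ par e.
Proof.
move=> eG; rewrite cosE_real // phase_Gl // cos_natpi signr_odd cRX; congr (_ ^+ _).
by rewrite cRN cR1.
Qed.

Lemma sinE_Gl e : e \in Gl -> sinE L cl e = 0.
Proof. by move=> eG; rewrite sinE_real // phase_Gl // sin_natpi mul0r. Qed.

Lemma sinE_off e : e \notin Gl -> sinE L cl e != 0.
Proof.
have k0 : 0 < k by rewrite sqrtr_gt0.
apply: contra => /eqP; rewrite sinE_real // => /eqP.
rewrite cR_eq0 mulf_eq0 invr_eq0 (gt_eqF k0) orbF => /eqP h.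
have kL : 0 <= k * L e by rewrite mulr_ge0 ?ltW.
have [j hj] := sin_eq0 kL h; rewrite inE; apply/asboolP; exists j.
by rewrite mulrA -hj mulrC mulKf // gt_eqF.
Qed.

Definition restr : 'M[C]_(#|I|, #|Gl|) := \matrix_(i, j) (i == enum_rank (inl (enum_val j) : I))%:R.

Lemma mul_restr (w : 'rV[C]_#|I|) j : (w *m restr) 0 j = slope w (enum_val j).
Proof.
rewrite mxE (bigD1 (enum_rank (inl (enum_val j) : I))) //= mxE eqxx mulr1 big1 ?addr0 // => x nx.
by rewrite mxE (negbTE nx) mulr0.
Qed.

Lemma extend_slope (b : 'rV[C]_#|Gl|) e :
  slope (b *m restr^T) e = \sum_j b 0 j * (e == enum_val j)%:R.
Proof.
rewrite /slope mxE; apply: eq_bigr => j _; rewrite !mxE (inj_eq enum_rank_inj).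
by rewrite (inj_eq (@inl_inj _ _)).
Qed.

Lemma extend_value (b : 'rV[C]_#|Gl|) v : value (b *m restr^T) v = 0.
Proof.
rewrite /value mxE big1 // => j _; rewrite !mxE (inj_eq enum_rank_inj).
by rewrite (_ : (inr v == inl _) = false) ?mulr0.
Qed.

Lemma extend_off (b : 'rV[C]_#|Gl|) e : e \notin Gl -> slope (b *m restr^T) e = 0.
Proof.
move=> eG; rewrite extend_slope big1 // => j _.
suff -> : (e == enum_val j) = false by rewrite mulr0.
by apply: contraNF eG => /eqP ->; exact: enum_valP.
Qed.

Lemma restrK (b : 'rV[C]_#|Gl|) : b *m restr^T *m restr = b.
Proof.
apply/rowP => j; rewrite mul_restr extend_slope (bigD1 j) //= eqxx mulr1 big1 ?addr0 // => i ij.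
by rewrite (inj_eq enum_val_inj) eq_sym (negbTE ij) mulr0.
Qed.

Lemma extendK (w : 'rV[C]_#|I|) : (forall v, value w v = 0) ->
  (forall e, e \notin Gl -> slope w e = 0) -> w *m restr *m restr^T = w.
Proof.
move=> h1 h2; apply: row_eqP => [e|v]; last by rewrite extend_value h1.
have [eG|eG] := boolP (e \in Gl); last by rewrite extend_off // h2.
rewrite extend_slope (bigD1 (enum_rank_in eG e)) //= big1 ?addr0 => [|j nj].
  by rewrite mul_restr enum_rankK_in // eqxx mulr1.
suff -> : (e == enum_val j) = false by rewrite mulr0.
by apply: contraNF nj => /eqP h; apply/eqP/enum_val_inj; rewrite enum_rankK_in.
Qed.

(** With zero vertex values the continuity conditions read [s e * slope w e = 0] and hold
    automatically: the sine vanishes on [G_lam], the slope elsewhere. Only the flux conditions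
    remain. *)
Lemma ker_restr (w : 'rV[C]_#|I|) : (forall v, value w v = 0) ->
  (forall e, e \notin Gl -> slope w e = 0) ->
  w *m D0 = 0 <-> w *m restr *m signed_incid C o t Gl par = 0.
Proof.
move=> h1 h2.
have entry v : (w *m restr *m signed_incid C o t Gl par) 0 (enum_rank v) =
    \sum_(e | t e == v) (dsinE L cl e * value w (o e) + cosE L cl e * slope w e)
    - \sum_(e | o e == v) slope w e.
  rewrite mxE [X in X - _]big_mkcond [X in _ - X]big_mkcond -sumrB.
  rewrite (bigID (mem Gl)) /= [X in _ = _ + X]big1 ?addr0; last first.
    by move=> e eG; rewrite h1 h2 // !mulr0 addr0 !if_same subrr.
  rewrite [RHS]big_enum_val; apply: eq_bigr => j _.
  rewrite mul_restr mxE enum_rankK h1 mulr0 add0r cosE_Gl ?enum_valP //.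
  by case: (t _ == v); case: (o _ == v); rewrite /=; ring.
split=> [/kerDE[_ h]|h].
  by apply/rowP => i; rewrite -[in LHS](enum_valK i) entry h subrr mxE.
apply/kerDE; split=> [e|v].
  rewrite !h1 mulr0 add0r; have [eG|eG] := boolP (e \in Gl).
    by rewrite sinE_Gl // mul0r.
  by rewrite h2 // mulr0.
by apply/eqP; rewrite -subr_eq0 -entry h mxE.
Qed.

Hypothesis hB : forall v, boundary_vertex o t v || proper_core_vertex o t v ->
  exists k0, vB k0 = v.

Lemma rank_dirichlet_kernel : \rank (kermx D0 :&: kermx Sel^T)%MS =
  \rank (kermx (signed_incid C o t Gl par)).
Proof.
have inA (w : 'rV[C]_#|I|) : (w <= kermx D0 :&: kermx Sel^T)%MS ->
    [/\ w *m D0 = 0, forall v, value w v = 0 & forall e, e \notin Gl -> slope w e = 0].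
  rewrite sub_capmx => /andP[/sub_kermxP wD /sub_kermxP wS].
  have wv : forall v, value w v = 0.
    apply: (vanishes_at_vertices hL wD) => v /hB[k0 <-].
    by rewrite -mul_selB_tr wS mxE.
  split=> // e eG; have [/(_ e) h _] := (kerDE o t L lam w).1 wD.
  move: h; rewrite !wv mulr0 add0r => /esym/eqP.
  by rewrite mulf_eq0 (negbTE (sinE_off eG)) => /eqP.
apply: (@mxrank_iso _ _ _ _ _ _ _ restr restr^T).
- apply/row_subP => i; rewrite row_mul; apply/sub_kermxP.
  have [h1 h2 h3] := inA _ (row_sub i _).
  exact: ((ker_restr h2 h3).1 h1).
- apply/row_matrixP => i; rewrite (row_mul i _ restr^T) (row_mul i _ restr).
  have [h1 h2 h3] := inA _ (row_sub i _); exact: extendK.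
- apply/row_subP => i; rewrite row_mul; set b := row i (kermx _).
  have hb : b *m signed_incid C o t Gl par = 0 by apply/sub_kermxP; exact: row_sub.
  rewrite sub_capmx; apply/andP; split; apply/sub_kermxP.
    apply/(ker_restr (extend_value b) (@extend_off b)); by rewrite restrK.
  by apply/rowP => l; rewrite mul_selB_tr extend_value mxE.
- apply/row_matrixP => i; rewrite (row_mul i _ restr) (row_mul i _ restr^T); exact: restrK.
Qed.

End DirichletKernel.

(** Rank-nullity for evaluation at [vB] on [ker D0]. The image has the rank of the residue; the
    kernel has dimension [|E(G_lam)| - |V|] plus the number of balanced components, which is
    [beta1 - beta0_odd]. *)
Lemma rank_kernel (hB : forall v, boundary_vertex o t v || proper_core_vertex o t v ->
    exists k0, vB k0 = v) :
  ((\rank (kermx D0))%:Z = (\rank (Res_TW o t L vB lam))%:Z + beta1 o t (Elam L lam)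
    - (beta0_odd o t L (Elam L lam) (pi / k))%:Z)%R.
Proof.
have /fin_all_exists[n hn] (e : E) : exists n : nat,
    e \in Elam L lam -> L e = n%:R * (pi / k).
  have [|eG] := boolP (e \in Elam L lam); last by exists 0%N.
  by rewrite inE => /asboolP[n ->]; exists n.
have x0 : 0 < pi / k by rewrite divr_gt0 ?pi_gt0 // sqrtr_gt0.
have e1 := mxrank_mul_ker (kermx D0) Sel^T.
have e2 := rank_dirichlet_kernel hn hB.
have e3 := @rank_ker_incid C V E o t (Elam L lam) (fun e => odd (n e)).
have e4 := @beta0_oddE R V E o t L (Elam L lam) n (pi / k) x0 hn.
rewrite rank_Res /beta1; move: e1 e2 e3 e4.
move: (\rank (kermx D0)) (\rank (kermx D0 *m _)) (\rank (_ :&: _)%MS) (\rank (kermx (signed_incid _ _ _ _ _))).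
move: (beta0 o t _) (beta0_odd _ _ _ _ _) #|Elam L lam| #|balanced_comps _ _ _ _| #|V|.
clear; lia.
Qed.

Definition eigfun (w : 'rV[C]_#|I|) (e : E) (x : R) : C :=
  if 0 <= x <= L e then sol_of o cl w e x else 0.

Lemma eigfun_ker (w : 'rV[C]_#|I|) : w *m D0 = 0 -> kerset o t L lam (eigfun w).
Proof.
move=> hw.
have hw' : w *m D0 = rhs E (fun _ : V => 0 : C).
  rewrite hw; apply: row_eqP => [e|v]; first by rewrite rhs_slope /slope mxE.
  by rewrite rhs_value /value mxE.
have [h1 h2 h3] := sol_ofP hw'.
have E0 e : 0 <= (0 : R) <= L e by rewrite lexx ltW.
have E1 e : 0 <= L e <= L e by rewrite lexx ltW.
have Ein e x : 0 <= x <= L e -> sol_of o cl w e x = eigfun w e x.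
  by rewrite /eigfun => ->.
split; first by move=> e x /negP/negbTE; rewrite /eigfun => ->.
exists (dsol_of o cl w), (value w); split; last exact: h3.
- move=> e; have [d1 [f2 [d2 d3]]] := h1 e; split.
    by apply: deriv_on_ext d1 => // x hx; exact: Ein.
  by exists f2; split; [exact: d2|move=> x hx; rewrite d3 // Ein].
- move=> e; have [<- <-] := h2 e; split; symmetry; exact: Ein.
Qed.

Lemma eigfun_onto f : kerset o t L lam f -> exists2 w, w *m D0 = 0 & f = eigfun w.
Proof.
move=> [f0 [f1 [F [h1 h2 h3]]]]; exists (data_row f1 F).
  rewrite (sol_data_row hL h1 h2 h3); apply/rowP => i; rewrite !mxE.
  by case: (enum_val i).
apply/funext => e; apply/funext => x; rewrite /eigfun.
case: (boolP (0 <= x <= L e)) => hx; last by apply: f0; apply/negP.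
have [-> _] := edge_sol_formula h1 hx; have [-> _] := h2 e.
by rewrite /sol_of data_slope data_value.
Qed.

Lemma eigfun_inj (w : 'rV[C]_#|I|) : w *m D0 = 0 -> eigfun w = (fun _ _ => 0) -> w = 0.
Proof.
move=> /kerDE[w1 _] hf.
have ev e x : 0 <= x <= L e -> sol_of o cl w e x = 0.
  by move=> hx; have := congr1 (fun g => g e x) hf; rewrite /eigfun hx.
have E0 e : 0 <= (0 : R) <= L e by rewrite lexx ltW.
have z1 e : value w (o e) = 0.
  by have := ev e 0 (E0 e); rewrite /sol_of !fsol_at0 mulr1 mulr0 addr0.
have k0 : 0 < k by rewrite sqrtr_gt0.
have z2 e : slope w e = 0.
  (* At this point [0 < k x <= 1 < pi], so the sine is nonzero and the slope can be read off from a
     value of the function. *)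
  pose x := Num.min (L e) (1 / k).
  have x0 : 0 < x by rewrite lt_min hL divr_gt0.
  have xL : 0 <= x <= L e by rewrite ltW // ge_min lexx.
  have := ev e x xL; rewrite /sol_of z1 mul0r add0r => /eqP.
  rewrite mulf_eq0 => /orP[/eqP //|].
  have [_] := fsol_real k0 (ltW x0); rewrite sqr_sqrtr ?ltW // => ->.
  rewrite cR_eq0 mulf_eq0 invr_eq0 (gt_eqF k0) orbF gt_eqF //.
  apply: sin_gt0_pi; rewrite mulr_gt0 //=.
  apply: (@le_lt_trans _ _ 1); last by have := @pi_ge2 R; lra.
  by rewrite mulrC -ler_pdivlMr // ge_min lexx orbT.
apply: row_eqP => [e|v]; first by rewrite z2 /slope mxE.
rewrite [RHS]mxE; have := hnoiso v; rewrite lt0n sum_nat_eq0 negb_forall => /existsP[e].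
rewrite inE /= addn_eq0 negb_and !eqb0 !negbK => /orP[]/eqP <-; first exact: z1.
by rewrite w1 z1 z2 !mulr0 addr0.
Qed.

Lemma eigfun_lin d (a : 'rV[C]_d) (B : 'M[C]_(d, #|I|)) :
  eigfun (a *m B) = (fun e x => \sum_i a 0 i * eigfun (row i B) e x).
Proof.
apply/funext => e; apply/funext => x; rewrite /eigfun.
case: (0 <= x <= L e); last by rewrite big1 // => i _; rewrite mulr0.
rewrite /sol_of /value /slope !mxE !mulr_suml -big_split; apply: eq_bigr => i _ /=.
by rewrite !mxE; ring.
Qed.

Lemma kerset_dim : has_dim (kerset o t L lam) (\rank (kermx D0)).
Proof.
pose B := row_base (kermx D0).
have Bker i : row i B *m D0 = 0.
  by apply/sub_kermxP; rewrite (submx_trans (row_sub i B)) // eq_row_base.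
exists (fun i => eigfun (row i B)); split.
- by move=> i; apply: eigfun_ker; exact: Bker.
- move=> a ha i; pose r := \row_j a j.
  have rE : eigfun (r *m B) = (fun _ _ => 0).
    rewrite eigfun_lin -ha; apply/funext => e; apply/funext => x.
    by apply: eq_bigr => j _; rewrite mxE.
  have rB : r *m B = 0.
    apply: eigfun_inj rE; apply/sub_kermxP.
    by rewrite (submx_trans (submxMl _ _)) // eq_row_base.
  have /eqP : r *m B = 0 *m B by rewrite mul0mx.
  move=> /eqP /(row_free_inj (row_base_free _)) /rowP /(_ i).
  by rewrite !mxE.
- move=> f /eigfun_onto[w /sub_kermxP wD ->].
  have /submxP[a ->] : (w <= B)%MS by rewrite eq_row_base.
  by exists (fun i => a 0 i); rewrite eigfun_lin.
Qed.

Lemma eigenvalue_dim d : has_dim (kerset o t L lam) d ->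
  is_eigenvalue o t L lam <-> (0 < d)%N.
Proof.
move=> [b [b1 b2 b3]]; split=> [[f /b3[a ->] fn0]|d0].
  rewrite lt0n; apply/eqP => d0; apply: fn0; apply/funext => e; apply/funext => x.
  by rewrite big1 // => -[i hi]; exfalso; rewrite d0 in hi.
exists (b (Ordinal d0)) => // h.
have hc : (fun e x => \sum_i ((i == Ordinal d0)%:R : C) * b i e x) = (fun _ _ => 0).
  apply/funext => e; apply/funext => x; rewrite (bigD1 (Ordinal d0)) // eqxx mul1r h /=.
  by rewrite add0r big1 // => i /negbTE ->; rewrite mul0r.
have := b2 (fun i => (i == Ordinal d0)%:R) hc (Ordinal d0).
by rewrite eqxx => /eqP; rewrite oner_eq0.
Qed.

End Residue.

Theorem theorem4p6 (R : realType) (V E : finType) (o t : E -> V) (L : E -> R)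
    (hL : forall e, 0 < L e)
    (hnoiso : forall v, (0 < deg o t [set: E] v)%N)
    (m : nat) (vB : 'I_m -> V) (hinj : injective vB)
    (hB : forall v, boundary_vertex o t v || proper_core_vertex o t v ->
                    exists k, vB k = v)
    (lam : R) (hlam : 0 < lam) :
  let Gl := Elam L lam in
  let b1 := beta1 o t Gl in
  let b0o := (beta0_odd o t L Gl (pi / Num.sqrt lam))%:Z in
  (b1 = b0o ->
     (is_eigenvalue o t L lam <-> is_pole o t L vB lam) /\
     has_dim (kerset o t L lam) (\rank (Res_TW o t L vB lam))) /\
  (b0o < b1 ->
     is_eigenvalue o t L lam /\
     exists d : nat,
       [/\ has_dim (kerset o t L lam) d,
           d%:Z = (\rank (Res_TW o t L vB lam))%:Z + b1 - b0o
         & is_pole o t L vB lam <-> b1 - b0o < d%:Z]).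
Proof.
move=> Gl b1 b0o.
have hd := kerset_dim hL hnoiso hlam.
have hev := eigenvalue_dim hd.
have hr := rank_kernel hL hnoiso hlam hB.
rewrite -/Gl -/b1 -/b0o in hr; rewrite /is_pole.
move: hd hev hr; move: (\rank (kermx _)) (\rank (Res_TW _ _ _ _ _)) => d r hd hev hr.
split=> hb.
  have dr : d = r by move: hr hb; clear; lia.
  by rewrite -dr.
split; first by apply/hev; move: hr hb; clear; lia.
exists d; split=> //.
by split; move: hr hb; clear; lia.
Qed.
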